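(* Let $d\in\mathbb{N}$, let $\Omega\subseteq\mathbb{R}^d$ be an open set, $F$ a locally convex space, $K_1\subseteq K_2\subseteq\cdots$ a compact exhaustion of $\Omega$, and $\ell\in\mathbb{N}_0$. Then there exist continuous linear operators $$S_n\colon C^\ell(\Omega,F)\to C^\infty(\Omega,F)\qquad (n\in\mathbb{N})$$ with the following properties: (a) $S_n(\gamma)\to\gamma$ in $C^\ell(\Omega,F)$ as $n\to\infty$, for all $\gamma\in C^\ell(\Omega,F)$; (b) $S_n(\gamma)\in F\otimes C^\infty_{K_{n+1}}(\Omega,\mathbb{R})$ for all $n\in\mathbb{N}$ and $\gamma\in C^\ell(\Omega,F)$; and (c) $S_m(\gamma)\in F\otimes C^\infty_{K_{n+1}}(\Omega,\mathbb{R})$ for all $n\in\mathbb{N}$, $m\ge n$, and $\gamma\in C^\ell_{K_n}(\Omega,F)$.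
   Context: $\mathbb{N}=\{1,2,\ldots\}$, $\mathbb{N}_0=\mathbb{N}\cup\{0\}$. ''Locally convex space'' means a real, Hausdorff locally convex topological vector space (not assumed complete). For open $\Omega\subseteq\mathbb{R}^d$ and $\ell\in\mathbb{N}_0\cup\{\infty\}$, $C^\ell(\Omega,F)$ is the vector space of continuous maps $\gamma\colon\Omega\to F$ whose partial derivatives $\partial^\alpha\gamma\colon\Omega\to F$ exist and are continuous for all multi-indices $\alpha\in\mathbb{N}_0^d$ with $|\alpha|\le\ell$. It carries the compact-open $C^\ell$-topology: the initial topology with respect to the maps $C^\ell(\Omega,F)\to C(\Omega,F)$, $\gamma\mapsto\partial^\alpha\gamma$, for $|\alpha|\le\ell$, where $C(\Omega,F)$ has the compact-open topology. For compact $K\subseteq\Omega$, $C^\ell_K(\Omega,F)$ is the subspace of those $\gamma\in C^\ell(\Omega,F)$ with support contained in $K$. $F\otimes C^\infty_K(\Omega,\mathbb{R})$ is identified with the linear span, in the space of $F$-valued functions, of the functions $x\mapsto\gamma(x)v$ with $v\in F$, $\gamma\in C^\infty_K(\Omega,\mathbb{R})$. A compact exhaustion of $\Omega$ is a sequence of compact sets $K_n$ with $\bigcup_nK_n=\Omega$ and $K_n$ contained in the interior of $K_{n+1}$ for each $n$. *)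

(* Defs.v *)
From HB Require Import structures.
From mathcomp Require Import all_boot all_order all_algebra.
From mathcomp Require Import all_classical all_reals all_analysis.

Set Implicit Arguments.
Unset Strict Implicit.
Unset Printing Implicit Defensive.

Import Order.TTheory GRing.Theory Num.Theory.
Import numFieldNormedType.Exports.

Local Open Scope classical_set_scope.
Local Open Scope ring_scope.

HB.mixin Record Tvs_isHausdorff (R : numDomainType) E & Tvs R E := {
  lcs_hausdorff : hausdorff_space E }.

(* Completeness is not assumed. *)
#[short(type="lcsType")]
HB.structure Definition LocallyConvexSpace (R : numDomainType) :=
  {E of Tvs R E & Tvs_isHausdorff R E}.

HB.instance Definition _ (R : realType) :=
  Tvs_isHausdorff.Build R R^o (@Rhausdorff R).

Section PartialDerivatives.
Context {R : realType} {d : nat} {Omega : set 'rV[R]_d} {F : lcsType R}.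
Implicit Types (f g : Omega -> F) (i : 'I_d) (w : seq 'I_d).

(* f is extended by 0 outside Omega. When Omega is open the extension is
   irrelevant, since only small h matter. *)
Definition diff_quotient f i (x : Omega) (h : R) : F :=
  h^-1 *: ('valL_0 f (set_val x + h *: delta_mx 0 i) - f x).

(* The library's [lim] and [cvg] need a pointed type, which tvsType does not
   provide; pderiv is 0 where the limit does not exist. *)
Definition pderivable f i (x : Omega) : Prop :=
  exists v : F, diff_quotient f i x h @[h --> 0^'] --> v.

Definition pderiv f i : Omega -> F :=
  fun x => xget 0 [set v : F | diff_quotient f i x h @[h --> 0^'] --> v].

Lemma pderivP f i x (v : F) :
  diff_quotient f i x h @[h --> 0^'] --> v -> pderiv f i x = v.
Proof.
move=> fv; rewrite /pderiv; case: xgetP => [w _ /= fw|/(_ v)//].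
exact: (cvg_unique (@lcs_hausdorff _ F) fw fv).
Qed.

Fixpoint pderivs w f : Omega -> F :=
  if w is i :: w' then pderiv (pderivs w' f) i else f.

Fixpoint pderivables w f : Prop :=
  if w is i :: w'
  then pderivables w' f /\ forall x, pderivable (pderivs w' f) i x
  else True.

(* A multi-index; alpha stands for d_0^(alpha 0) ... d_(d-1)^(alpha (d-1)),
   the last coordinate being differentiated first. *)
Definition mindex_word (alpha : 'I_d -> nat) : seq 'I_d :=
  flatten [seq nseq (alpha i) i | i <- enum 'I_d].

Definition mdegree (alpha : 'I_d -> nat) : nat := (\sum_i alpha i)%N.

Definition mpderiv alpha f : Omega -> F := pderivs (mindex_word alpha) f.

Definition mpderivable alpha f : Prop := pderivables (mindex_word alpha) f.

(* The order of smoothness, an element of N_0 \cup {oo}: None is oo. *)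
Definition le_order (n : nat) (l : option nat) : bool :=
  if l is Some k then (n <= k)%N else true.

Definition is_Ck (l : option nat) f : Prop :=
  continuous f /\
  forall alpha, le_order (mdegree alpha) l ->
    mpderivable alpha f /\ continuous (mpderiv alpha f).

Lemma diff_quotientP (a : R) f g i x h :
  diff_quotient (a *: f + g) i x h =
  a *: diff_quotient f i x h + diff_quotient g i x h.
Proof.
rewrite /diff_quotient.
set y := _ + _ *: _.
have -> : 'valL_0 (a *: f + g) y = a *: 'valL_0 f y + 'valL_0 g y.
  rewrite /valL_ /=; case: ('oinv_set_val y) => //=.
  by rewrite scaler0 addr0.
rewrite scalerA mulrC -scalerA -scalerDr; congr (_ *: _).
by rewrite scalerBr opprD addrACA.
Qed.

Lemma cvg_lincomb {T : Type} (G : set_system T) (FG : Filter G) (a : R)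
    (u v : T -> F) (p q : F) :
  u @ G --> p -> v @ G --> q -> (fun t => a *: u t + v t) @ G --> a *: p + q.
Proof.
move=> up vq.
have sp : (fun t => a *: u t) @ G --> a *: p.
  apply: (@cvg_comp _ _ _ u (fun z : F => a *: z) G (nbhs p)) => //.
  apply: (@continuous_comp F (R^o * F)%type F (fun z => (a, z))
    (fun z => z.1 *: z.2)); last exact: scale_continuous.
  by apply: (@cvg_pair _ _ _ _ (nbhs (a : R^o))); [exact: cvg_cst|exact: cvg_id].
apply: (@cvg_comp _ _ _ (fun t => (a *: u t, v t)) (fun z : F * F => z.1 + z.2)
  G (nbhs (a *: p, q))); first exact: cvg_pair.
exact: (@add_continuous F (a *: p, q)).
Qed.

Lemma pderiv_lincomb (a : R) f g i x :
  pderivable f i x -> pderivable g i x ->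
  pderivable (a *: f + g) i x /\
  pderiv (a *: f + g) i x = a *: pderiv f i x + pderiv g i x.
Proof.
move=> [p fp] [q gq].
have H : diff_quotient (a *: f + g) i x h @[h --> 0^'] --> a *: p + q.
  under eq_fun do rewrite diff_quotientP.
  exact: cvg_lincomb.
rewrite (pderivP fp) (pderivP gq) (pderivP H).
by split => //; exists (a *: p + q).
Qed.

Lemma pderivs_lincomb (a : R) f g w :
  pderivables w f -> pderivables w g ->
  pderivables w (a *: f + g) /\
  pderivs w (a *: f + g) = a *: pderivs w f + pderivs w g.
Proof.
elim: w => [//|i w IHw] /= [wf df] [wg dg].
have [wfg ->] := IHw wf wg.
split; first by split => // x; have [] := pderiv_lincomb a (df x) (dg x).
by apply/funext => x; have [_ ->] := pderiv_lincomb a (df x) (dg x).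
Qed.

Lemma continuous_lincomb (a : R) f g :
  continuous f -> continuous g -> continuous (a *: f + g).
Proof. by move=> cf cg x; apply: (cvg_lincomb (G := nbhs x)); [exact: cf|exact: cg]. Qed.

Lemma pderiv0 i : pderiv 0 i = 0 :> (Omega -> F) /\ forall x, pderivable (0 : Omega -> F) i x.
Proof.
have H x : diff_quotient (0 : Omega -> F) i x h @[h --> 0^'] --> (0 : F).
  rewrite (_ : diff_quotient _ _ _ = cst 0); first exact: cvg_cst.
  apply/funext => h; rewrite /diff_quotient /valL_ /=.
  by case: ('oinv_set_val _) => /= [?|]; rewrite subrr scaler0.
split; last by move=> x; exists 0.
by apply/funext => x; apply: pderivP.
Qed.

Lemma pderivs0 w :
  pderivables w (0 : Omega -> F) /\ pderivs w (0 : Omega -> F) = 0.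
Proof.
elim: w => [//|i w [IHw IHe]] /=; have [e de] := pderiv0 i.
by rewrite IHe.
Qed.

End PartialDerivatives.

Section CkSpaces.
Context {R : realType} {d : nat}.
Variables (l : option nat) (Omega : set 'rV[R]_d) (F : lcsType R).

Definition Ck_pred : {pred Omega -> F} := fun f => `[< is_Ck l f >].

Lemma Ck_submod_closed : submod_closed Ck_pred.
Proof.
split.
  apply/asboolP; split; first exact: cst_continuous.
  move=> alpha _; have [w0 e0] := @pderivs0 R d Omega F (mindex_word alpha).
  by split => //; rewrite /mpderiv e0; exact: cst_continuous.
move=> a f g /asboolP[cf Hf] /asboolP[cg Hg]; apply/asboolP.
split; first exact: continuous_lincomb.
move=> alpha al; have [wf cwf] := Hf _ al; have [wg cwg] := Hg _ al.
have [w e] := pderivs_lincomb a wf wg.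
by split => //; rewrite /mpderiv e; exact: continuous_lincomb.
Qed.

HB.instance Definition _ :=
  GRing.isSubmodClosed.Build R (Omega -> F) Ck_pred Ck_submod_closed.

Record Ck_space := CkSpace {
  Ck_fun :> Omega -> F ;
  Ck_funP : Ck_fun \in Ck_pred }.

HB.instance Definition _ := [isSub for Ck_fun].
HB.instance Definition _ := [Choice of Ck_space by <:].
HB.instance Definition _ := [SubChoice_isSubLmodule of Ck_space by <:].

(* The compact-open C^l-topology: the coarsest topology making all the maps
   mpderiv alpha with |alpha| <= l continuous into the compact-open topology. *)
Definition Ck_pderiv_map (alpha : {alpha | le_order (@mdegree d alpha) l})
  (f : Ck_space) : {compact-open, Omega -> F} := mpderiv (sval alpha) f.

Definition Ck_topology := sup_topology (fun alpha =>
  Topological.class (initial_topology (Ck_pderiv_map alpha))).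

HB.instance Definition _ := Topological.copy Ck_space Ck_topology.

End CkSpaces.

Notation "''C^' l ( Omega , F )" := (Ck_space l Omega F)
  (at level 8, l at level 2, format "''C^' l ( Omega ,  F )") : type_scope.
Notation "''C^oo' ( Omega , F )" := (Ck_space None Omega F)
  (at level 8, format "''C^oo' ( Omega ,  F )") : type_scope.

Lemma Ck_cvgP (R : realType) (d : nat) (l : option nat) (Omega : set 'rV[R]_d)
    (F : lcsType R) (G : set_system 'C^l(Omega, F)) (f : 'C^l(Omega, F)) :
  Filter G ->
  G --> f <->
  forall alpha : {alpha | le_order (mdegree alpha) l},
    {compact-open, (Ck_pderiv_map alpha @ G) --> Ck_pderiv_map alpha f}.
Proof.
move=> FG; split => [/cvg_sup Gf alpha|Gf].
  move=> A /(@initial_continuous _ _ (Ck_pderiv_map alpha) f A).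
  exact: Gf.
apply/cvg_sup => alpha A [B [[C oC <-]] Cf CA].
apply: (filterS CA); apply: (Gf alpha).
exact: open_nbhs_nbhs.
Qed.

Arguments Ck_pred {R d} l {Omega F} f.

Section Inclusion.
Context {R : realType} {d : nat} {Omega : set 'rV[R]_d} {F : lcsType R}.

Lemma smooth_Ck (l : option nat) (f : 'C^oo(Omega, F)) :
  (f : Omega -> F) \in Ck_pred l.
Proof.
have /asboolP[cf Hf] := Ck_funP f.
by apply/asboolP; split => // alpha _; exact: Hf.
Qed.

Definition smooth_incl (l : option nat) (f : 'C^oo(Omega, F)) :
  'C^l(Omega, F) := CkSpace (smooth_Ck l f).

(* The support, a subset of R^d; the closure is taken relative to Omega. *)
Definition fsupport (f : Omega -> F) : set 'rV[R]_d :=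
  set_val @` closure [set x : Omega | f x != 0].

End Inclusion.

Definition lin_span {R : pzRingType} {V : lmodType R} (A : set V) : set V :=
  [set u | exists s : seq (R * V),
    (forall p, p \in s -> A p.2) /\ u = \sum_(p <- s) p.1 *: p.2].

Definition tensor_smooth {R : realType} {d : nat} {Omega : set 'rV[R]_d}
    {F : lcsType R} (K : set 'rV[R]_d) : set (Omega -> F) :=
  lin_span [set u | exists (v : F) (g : 'C^oo(Omega, R^o)),
    fsupport g `<=` K /\ u = fun x => g x *: v].

(* Sequences start at 0: K n is the set written K_(n+1) when the index set is
   {1, 2, ...}. The union condition makes every K n a subset of Omega. *)
Definition compact_exhaustion {R : realType} {d : nat} (Omega : set 'rV[R]_d)
    (K : nat -> set 'rV[R]_d) : Prop :=
  [/\ forall n, compact (K n), \bigcup_n K n = Omega &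
      forall n, K n `<=` (K n.+1)°].

(* Main.v *)
(** [S_n g] samples [g] on the lattice [h Z^d] inside [K n], with [h = h_n]
    small, and puts at each sample point a smooth bump:
    [S_n g (x) = \sum_z \prod_i phi_l (x_i / h - z_i) *: g (h z)].
    The functions [phi_k] form a chain of smooth compactly supported partitions
    of unity with [phi_(k+1)' (t) = phi_k t - phi_k (t - 1)]. Summation by parts
    turns a partial derivative of [S_n g] of order [alpha], [|alpha| <= l], into
    an average, with nonnegative weights of total mass 1, of iterated difference
    quotients of [g] at points close to [x]. If [C] is an open convex set
    containing the values of the [alpha]-th derivative of [g] near [x], the mean
    value theorem puts these difference quotients, hence the average, into [C].
    No integral of an [F]-valued function is formed, so [F] need not be
    complete, and each [S_n g] has finite-dimensional range. *)
From HB Require Import structures.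
Require Import Defs.
From mathcomp Require Import all_boot all_order all_algebra.
From mathcomp Require Import all_classical all_reals all_analysis.
From mathcomp Require Import ring lra zify.
Import Order.TTheory GRing.Theory Num.Theory.
Import numFieldNormedType.Exports.
Local Open Scope classical_set_scope.
Local Open Scope ring_scope.

Set Implicit Arguments.
Unset Strict Implicit.
Unset Printing Implicit Defensive.

(** * Smooth functions of one real variable *)

Section Smooth1.
Context {R : realType}.
Implicit Types (f g : R -> R).

(** The derivative is carried as a witness instead of [derive1 f], so closure under sums and
    products only has to exhibit it. *)
Fixpoint diffn n f : Prop :=
  if n is n'.+1 then
    exists2 df : R -> R, (forall x : R, is_derive x (1 : R) f (df x)) & diffn n' df
  else True.

Definition smooth f := forall n, diffn n f.

Lemma is_derive1_derive1 f (df : R -> R) :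
  (forall x : R, is_derive x (1 : R) f (df x)) -> derive1 f = df.
Proof. by move=> fdf; apply/funext => x; rewrite derive1E; case: (fdf x). Qed.

Lemma smooth_is_derive f (x : R) : smooth f -> is_derive x (1 : R) f (derive1 f x).
Proof. by move=> /(_ 1%N)[df fdf _]; rewrite (is_derive1_derive1 fdf). Qed.

Lemma smooth_derive1 f : smooth f -> smooth (derive1 f).
Proof.
by move=> sf n; have [df fdf sdf] := sf n.+1; rewrite (is_derive1_derive1 fdf).
Qed.

Lemma smooth_primitive f g :
  (forall x : R, is_derive x (1 : R) f (g x)) -> smooth g -> smooth f.
Proof. by move=> fg sg [//|n]; exists g. Qed.

Lemma is_derive1_continuous f (df : R -> R) :
  (forall x : R, is_derive x (1 : R) f (df x)) -> continuous f.
Proof.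
move=> fdf x; apply: differentiable_continuous; apply/derivable1_diffP.
by have [] := fdf x.
Qed.

Lemma smooth_continuous f : smooth f -> continuous f.
Proof. by move=> sf; apply: is_derive1_continuous => x; exact: smooth_is_derive. Qed.

Lemma MVT_global f (df : R -> R) (a b : R) :
  a < b -> (forall x : R, is_derive x (1 : R) f (df x)) ->
  exists c, [/\ a < c, c < b & f b - f a = df c * (b - a)].
Proof.
move=> ab fdf; have [|c cab e] := @MVT R f df a b ab (fun x _ => fdf x).
  by apply: continuous_subspaceT; exact: is_derive1_continuous fdf.
by exists c; split => //; move: cab; rewrite in_itv/= => /andP[].
Qed.

Lemma diffn_leS n f : diffn n.+1 f -> diffn n f.
Proof.
elim: n f => [//|n IHn] f [df fdf sdf]; exists df => //; exact: IHn.
Qed.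

Lemma smooth_cst (c : R) : smooth (cst c).
Proof.
move=> n; elim: n c => [//|n IHn] c; exists (cst 0) => // x.
exact: is_derive_cst.
Qed.

Lemma diffnD n f g : diffn n f -> diffn n g -> diffn n (f + g).
Proof.
elim: n f g => [//|n IHn] f g [df fdf sdf] [dg gdg sdg].
exists (df + dg) => [x|]; last exact: IHn.
exact: is_deriveD.
Qed.

Lemma diffnM n f g : diffn n f -> diffn n g -> diffn n (f * g).
Proof.
elim: n f g => [//|n IHn] f g sf sg.
have [df fdf sdf] := sf; have [dg gdg sdg] := sg.
exists (f * dg + g * df) => [x|]; first exact: is_deriveM.
by apply: diffnD; apply: IHn => //; exact: diffn_leS.
Qed.

Lemma is_derive_affine f (a b x y : R) :
  is_derive (a * x + b) (1 : R) f y ->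
  is_derive x (1 : R) (fun x => f (a * x + b)) (a * y).
Proof.
move=> fy; rewrite mulrC; apply: (@is_derive1_comp _ f (fun x => a * x + b)) => //.
have -> : (fun x => a * x + b) = horner (a *: 'X + b%:P).
  by apply/funext => z; rewrite !hornerE.
apply: (is_derive_eq (is_derive_poly _ x)).
by rewrite derivD derivZ derivX derivC !hornerE.
Qed.

Lemma diffn_affine n f (a b : R) :
  diffn n f -> diffn n (fun x => f (a * x + b)).
Proof.
elim: n f => [//|n IHn] f [df fdf sdf].
exists (cst a * (fun x => df (a * x + b))) => [x|].
  exact: is_derive_affine.
apply: diffnM; [exact: smooth_cst | exact: IHn].
Qed.

Lemma smoothM f g : smooth f -> smooth g -> smooth (f * g).
Proof. by move=> sf sg n; apply: diffnM. Qed.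

Lemma smooth_affine f (a b : R) : smooth f -> smooth (fun x => f (a * x + b)).
Proof. by move=> sf n; apply: diffn_affine. Qed.

Lemma smoothD f g : smooth f -> smooth g -> smooth (f + g).
Proof. by move=> sf sg n; apply: diffnD. Qed.

End Smooth1.

(** * Functions that are flat at the origin *)

Section Flat.
Context {R : realType}.
Implicit Types (p q : {poly R}).

(* The derivative of [flat p] is [flat q] for another polynomial [q], so this
   family is closed under differentiation. *)
Definition flat p (t : R) : R := if 0 < t then p.[t^-1] * expR (- t^-1) else 0.

(** For [y >= 0] each monomial satisfies [y^i <= i! exp y]; these bounds are added with the weights
    [|p_i|]. *)
Lemma poly_le_expR p :
  exists2 C, 0 <= C & forall y : R, 0 <= y -> `|p.[y]| <= C * expR y.
Proof.
exists (\sum_(i < size p) `|p`_i| * i`!%:R).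
  by apply: sumr_ge0 => i _; rewrite mulr_ge0.
move=> y y0; rewrite horner_coef mulr_suml (le_trans (ler_norm_sum _ _ _))//.
apply: ler_sum => i _; rewrite normrM -mulrA ler_wpM2l// ger0_norm ?exprn_ge0//.
have fi : 0 < (i`!%:R : R) by rewrite ltr0n fact_gt0.
rewrite mulrC -ler_pdivrMr//.
case: {fi} (i : nat) => [|k].
  by rewrite expr0 divr1 (le_trans _ (expR_ge1Dx _))// lerDl.
by rewrite (le_trans _ (expR_ge1Dxn k y0))// lerDr.
Qed.

(** The exponential bound is taken for ['X * p] at [1/t]: the extra factor [1/t] on the left becomes
    [|t|] on the right. *)
Lemma flat_le p : exists2 C, 0 <= C & forall t : R, `|flat p t| <= C * `|t|.
Proof.
have [C C0 HC] := poly_le_expR ('X * p).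
exists C => // t; rewrite /flat; case: ifPn => t0; last by rewrite normr0 mulr_ge0.
have := HC t^-1; rewrite invr_ge0 ltW// => /(_ isT).
rewrite hornerM hornerX expRN !normrM !normfV (gtr0_norm (expR_gt0 _)).
rewrite (gtr0_norm t0) mulrC ler_pdivrMr// => H.
rewrite ler_pdivrMr ?expR_gt0//; apply: (le_trans H).
by rewrite mulrAC.
Qed.

Lemma flat_cvg0 p : flat p t @[t --> (0 : R)] --> (0 : R).
Proof.
have [C C0 HC] := flat_le p.
apply: (@squeeze_cvgr _ _ _ _ (fun t => - (C * `|t|)) (fun t => C * `|t|)).
- by apply: nearW => t; rewrite -ler_norml.
- rewrite -[X in _ --> X]oppr0; apply: cvgN.
  rewrite -[X in _ --> X](mulr0 C) -[X in C * X](@normr0 _ R); apply: cvgMr.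
  by apply: cvg_norm; exact: cvg_id.
- rewrite -[X in _ --> X](mulr0 C) -[X in C * X](@normr0 _ R); apply: cvgMr.
  by apply: cvg_norm; exact: cvg_id.
Qed.

Lemma is_derive_flat p (t : R) :
  is_derive t (1 : R) (flat p) (flat ('X^2 * (p - p^`())) t).
Proof.
have [t0|t0|->] := ltgtP t 0.
- rewrite [in X in is_derive _ _ _ X]/flat ltNge (ltW t0) /=.
  apply: (@near_eq_is_derive _ R R (cst (0 : R))).
  near=> s; rewrite /flat ltNge ltW//=; near: s; exact: lt_nbhsl.
- rewrite [in X in is_derive _ _ _ X]/flat t0.
  apply: (@near_eq_is_derive _ R R (fun s => p.[s^-1] * expR (- s^-1))).
    near=> s; rewrite /flat ifT//; near: s; exact: lt_nbhsr.
  have tn0 : t != 0 by rewrite gt_eqF.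
  have dV : is_derive t (1 : R) (fun s : R => s^-1) (- t ^- 2).
    apply: (is_derive_eq (@is_deriveV _ id t 1 1 tn0 _)).
    by rewrite /GRing.scale /= mulr1.
  have dp := @is_derive1_comp _ (horner p) (fun s : R => s^-1) t _ _
    (is_derive_poly p t^-1) dV.
  have dN : is_derive t (1 : R) (fun s : R => - s^-1) (t ^- 2).
    by apply: (is_derive_eq (@is_deriveN _ R R _ _ _ _ dV)); rewrite opprK.
  have de := @is_derive1_comp _ expR (fun s : R => - s^-1) t _ _
    (is_derive_expR (- t^-1)) dN.
  apply: (is_derive_eq (@is_deriveM _ R _ _ _ _ _ _ dp de)).
  rewrite /GRing.scale /= -!exprVn hornerM hornerXn hornerD hornerN.
  set e := expR _; set u := t^-1; set a := p.[u]; set b := _.[u]; ring.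
- rewrite [in X in is_derive _ _ _ X]/flat ltxx; apply/is_derive1_caratheodory.
  (* The difference quotient at 0 is [flat p t / t = flat ('X * p) t], again of the same family, so
     it tends to 0. *)
  exists (flat ('X * p)); split.
  + move=> z; rewrite /flat ltxx !subr0; case: ifPn => z0; last by rewrite mul0r.
    rewrite hornerM hornerX; set a := p.[_]; set e := expR _; field.
    by rewrite gt_eqF.
  + have e : flat ('X * p) 0 = 0 by rewrite /flat ltxx.
    suff : flat ('X * p) t @[t --> (0 : R)] --> flat ('X * p) 0 by [].
    by rewrite e; exact: flat_cvg0.
  + by rewrite /flat ltxx.
Unshelve. all: by end_near. Qed.

Lemma smooth_flat p : smooth (flat p).
Proof.
move=> n; elim: n p => [//|n IHn] p.
by exists (flat ('X^2 * (p - p^`()))) => // t; exact: is_derive_flat.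
Qed.

End Flat.

(** * Smooth steps and spline partitions of unity *)

Section SmoothStep.
Context {R : realType}.
Implicit Types (f g : R -> R).

Lemma continuous_primitive f : continuous f -> (forall x, x <= 0 -> f x = 0) ->
  exists2 g, (forall x : R, is_derive x (1 : R) g (f x)) &
             forall x, x <= 0 -> g x = 0.
Proof.
(* The base point -1 makes every [x >= 0] interior to the range of integration, as the fundamental
   theorem requires; near [x < 0] the primitive is 0. *)
move=> cf f0; pose g x := (\int[lebesgue_measure]_(t in [set` `[(-1 : R), x]]) f t).
have g0 x : x <= 0 -> g x = 0.
  move=> x0; rewrite /g (@eq_Rintegral _ _ _ _ _ (cst 0)).
    by rewrite /Rintegral integral0.
  by move=> t; rewrite inE /= in_itv/= => /andP[_ tx]; rewrite f0// (le_trans tx).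
exists g => // x; have [x0|x0] := ltP x 0.
  apply: (@near_eq_is_derive _ R R (cst 0)).
    near=> s; rewrite g0// ltW//; near: s; exact: lt_nbhsl.
  by rewrite f0 ?ltW//; exact: is_derive_cst.
have [||//||e d] := @continuous_FTC1_closed R f (-1) x (x + 1).
- by rewrite ltrDl.
- apply: continuous_compact_integrable; first exact: segment_compact.
  exact: continuous_subspaceT.
- by apply: lt_le_trans x0; rewrite ltrN10.
- exact: cf.
exact: (DeriveDef e (etrans (esym (derive1E _ _)) d)).
Unshelve. all: by end_near. Qed.

Lemma is_derive_shiftB f g : (forall x : R, is_derive x (1 : R) g (f x)) ->
  forall x : R, is_derive x (1 : R) (fun x => g x - g (x - 1)) (f x - f (x - 1)).
Proof.
move=> gf x; apply: (@is_deriveB _ R R g (fun x => g (x - 1))) => //.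
have -> : (fun x => g (x - 1)) = (fun x => g (1 * x + -1)).
  by apply/funext => y; rewrite mul1r.
apply: (is_derive_eq (@is_derive_affine _ g 1 (-1) x _ (gf _))).
by rewrite !mul1r.
Qed.

Lemma smooth_shiftB f : smooth f -> smooth (fun x => f x - f (x - 1)).
Proof.
move=> sf; have -> : (fun x => f x - f (x - 1)) =
    f + cst (-1) * (fun x => f (1 * x + -1)).
  by apply/funext => y; rewrite !fctE /= mul1r mulN1r.
by apply: smoothD => //; apply: smoothM; [exact: smooth_cst|exact: smooth_affine].
Qed.

Lemma nondecreasing_primitive f g : (forall x : R, is_derive x (1 : R) g (f x)) ->
  (forall x, 0 <= f x) -> {homo g : x y / x <= y}.
Proof.
move=> gf f0 x y; rewrite le_eqVlt => /predU1P[->//|xy].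
have [c [_ _ e]] := MVT_global xy gf.
by rewrite -subr_ge0 e mulr_ge0// subr_ge0 ltW.
Qed.

Definition smooth_step (L : R) f :=
  [/\ smooth f, forall x, x <= 0 -> f x = 0, forall x, L <= x -> f x = 1 &
      {homo f : x y / x <= y}].

Lemma smooth_step_exists : exists f, smooth_step 1 f.
Proof.
(* [b] is [exp (-1/t) exp (-1/(1 - t))] between 0 and 1 and vanishes elsewhere; the step is its
   primitive divided by the total mass [g 1]. *)
pose b := flat 1 * (fun t : R => flat 1 (-1 * t + 1)).
have sb : smooth b by apply: smoothM; [|apply: smooth_affine]; exact: smooth_flat.
have flat_ge0 t : 0 <= flat 1 t :> R.
  by rewrite /flat; case: ifP => // _; rewrite hornerC mul1r expR_ge0.
have b_ge0 t : 0 <= b t by rewrite mulr_ge0.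
have b0 t : t <= 0 -> b t = 0.
  by move=> t0; rewrite /b !fctE /flat ltNge t0 mul0r.
have b1 t : 1 <= t -> b t = 0.
  by move=> t1; rewrite /b !fctE [X in _ * X]/flat mulN1r addrC subr_gt0 ltNge t1 mulr0.
have [g gb g0] := continuous_primitive (smooth_continuous sb) b0.
have g1 : 0 < g 1.
  have [c [c0 c1 ]] := MVT_global ltr01 gb.
  rewrite (g0 0)// !subr0 mulr1 => ->; rewrite /b !fctE /flat mulN1r addrC subr_gt0 c0 c1.
  by rewrite !hornerC !mul1r mulr_gt0// expR_gt0.
have mg := nondecreasing_primitive gb b_ge0.
exists (cst (g 1)^-1 * g); split.
- apply: smoothM; first exact: smooth_cst.
  exact: smooth_primitive gb sb.
- by move=> x x0; rewrite fctE (g0 x x0) mulr0.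
- move=> x; rewrite le_eqVlt => /predU1P[<-|x1].
    by rewrite fctE /= mulVf// gt_eqF.
  have [c [c1 _]] := MVT_global x1 gb.
  rewrite b1 ?ltW// mul0r => /eqP; rewrite subr_eq0 => /eqP e.
  by rewrite fctE /= e mulVf// gt_eqF.
- by move=> x y xy; rewrite !fctE /= ler_wpM2l ?invr_ge0 ?(ltW g1)//; exact: mg.
Qed.

(** [g x] is the mean of [f] over the interval from [x - 1] to [x], so the ramp widens by 1;
    monotonicity of [f] makes the derivative of [g] nonnegative. *)
Lemma smooth_step_next (L : R) f : 0 <= L -> smooth_step L f ->
  exists g, smooth_step (L + 1) g /\
    forall x : R, is_derive x (1 : R) g (f x - f (x - 1)).
Proof.
move=> L0 [sf f0 f1 mf].
have [G Gf G0] := continuous_primitive (smooth_continuous sf) f0.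
have dg := is_derive_shiftB Gf.
exists (fun x => G x - G (x - 1)); split=> //; split.
- exact: smooth_primitive dg (smooth_shiftB sf).
- by move=> x x0; rewrite !G0 ?subr0//; lra.
- move=> x xL; have [|c [xc cx e]] := @MVT_global _ G f (x - 1) x _ Gf; first lra.
  by rewrite e f1; lra.
- by apply: (nondecreasing_primitive dg) => x; rewrite subr_ge0 mf//; lra.
Qed.

(* [phi k t = Phi_k t - Phi_k (t - 1)], where [Phi_0] is a smooth step from 0
   to 1 and [Phi_(k+1) t] is the integral of [Phi_k] over [[t - 1, t]]. *)
Lemma smooth_splines : exists phi : nat -> R -> R,
  [/\ forall k, smooth (phi k),
      forall k t, 0 <= phi k t,
      forall k t, phi k t != 0 -> 0 < t < k.+2%:R,
      forall k (t : R), is_derive t (1 : R) (phi k.+1) (phi k t - phi k (t - 1)) &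
      forall k s N, 0 <= s < 1 -> (k.+2 <= N)%N ->
        \sum_(j < N) phi k (s + j%:R) = 1].
Proof.
have [f0 sf0] := smooth_step_exists.
(* The step condition is a premise inside [rel], so that every pair has a successor and choice gives
   a total [next]; [sPhi] supplies the premise along the chain. *)
pose rel k (f g : R -> R) := smooth_step k.+1%:R f -> smooth_step k.+2%:R g /\
  forall x : R, is_derive x (1 : R) g (f x - f (x - 1)).
have /choice[next nextP] (p : nat * (R -> R)) : exists g, rel p.1 p.2 g.
  have [sp|nsp] := pselect (smooth_step p.1.+1%:R p.2); last by exists p.2.
  have [|g gP] := smooth_step_next _ sp; first by [].
  by exists g => _; rewrite -[p.1.+2]addn1 natrD.
pose Phi := fix Phi k := if k is k'.+1 then next (k', Phi k') else f0.
have sPhi k : smooth_step k.+1%:R (Phi k).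
  by elim: k => [//|k IHk]; have [] := nextP (k, Phi k) IHk.
have dPhi k : forall x : R, is_derive x (1 : R) (Phi k.+1) (Phi k x - Phi k (x - 1)).
  by have [] := nextP (k, Phi k) (sPhi k).
exists (fun k x => Phi k x - Phi k (x - 1)); split.
- by move=> k; apply: smooth_shiftB; have [] := sPhi k.
- by move=> k t; rewrite subr_ge0; have [_ _ _ ->//] := sPhi k; lra.
- move=> k t; have [_ P0 P1 _] := sPhi k; apply: contra_neqT.
  rewrite negb_and -!leNgt => /orP[t0|tk].
    by rewrite !P0 ?subrr//; lra.
  have e : k.+2%:R = k.+1%:R + 1 :> R by rewrite -[k.+2]addn1 natrD.
  by rewrite !P1 ?subrr//; rewrite e in tk; lra.
- by move=> k; apply: is_derive_shiftB.
- move=> k s N /andP[s0 s1] kN; have [_ P0 P1 _] := sPhi k.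
  (* The sum telescopes. Since [0 <= s < 1] and [N >= k + 2], the upper argument is at least
     [k + 1], where [Phi k] is 1, and the lower one at most 0. *)
  have -> : \sum_(j < N) (Phi k (s + j%:R) - Phi k (s + j%:R - 1)) =
      Phi k (s + N%:R - 1) - Phi k (s - 1).
    elim: {kN} N => [|N IHN]; first by rewrite big_ord0 addr0 subrr.
    have e : s + N.+1%:R - 1 = s + N%:R by rewrite -[N.+1]addn1 natrD; ring.
    by rewrite big_ord_recr /= IHN e; ring.
  have : k.+2%:R <= N%:R :> R by rewrite ler_nat.
  rewrite -[k.+2]addn1 natrD => kN'.
  by rewrite P1 ?P0 ?subr0 //; lra.
Qed.

End SmoothStep.

(** * Mean value theorems in a locally convex space *)

Section ConvexMVT.
Context {R : realType} {F : tvsType R}.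
Implicit Types (C : set F) (g : R -> F).

Definition convex C := forall (x y : F) (t : R), C x -> C y -> 0 <= t -> t <= 1 ->
  C (t *: x + (1 - t) *: y).

(** Local convexity of [F] enters here: convergence in [F] may be tested on open convex sets. *)
Lemma convex_nbhs (v : F) (O : set F) : nbhs v O ->
  exists C, [/\ open C, C v, C `<=` O & convex C].
Proof.
have [B Bcvx [Bopen Bnbhs]] := @locally_convex R F.
move=> /Bnbhs [C [BC Cv] CO]; exists C; split => //; first exact: Bopen.
move=> x y t Cx Cy t0 t1.
have := Bcvx C (mem_set BC) x y (Itv01 t0 t1) (mem_set Cx) (mem_set Cy).
by rewrite inE.
Qed.

(** Factoring out the total weight, rather than assuming it to be 1, lets the induction add one term
    at a time; [p0] serves when the total weight is 0. *)
Lemma convex_sum C (I : Type) (r : seq I) (P : pred I) (c : I -> R)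
    (v : I -> F) (p0 : F) :
  convex C -> C p0 -> (forall i, P i -> 0 <= c i) ->
  (forall i, P i -> c i != 0 -> C (v i)) ->
  exists2 p, C p &
    \sum_(i <- r | P i) c i *: v i = (\sum_(i <- r | P i) c i) *: p.
Proof.
move=> cC Cp0 c0 Cv.
elim: r => [|i r [p Cp IH]]; first by exists p0; rewrite // !big_nil scale0r.
rewrite !big_cons; case: ifP => Pi; last by exists p.
have [ci0|cin0] := eqVneq (c i) 0; first by exists p; rewrite // ci0 scale0r !add0r.
have ci : 0 < c i by rewrite lt_neqAle eq_sym cin0 c0.
rewrite IH; set S := \sum_(_ <- _ | _) c _ in IH *.
have S0 : 0 <= S by apply: sumr_ge0.
have cS : 0 < c i + S by rewrite ltr_wpDr.
exists (c i / (c i + S) *: v i + (1 - c i / (c i + S)) *: p).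
  apply: cC => //; [exact: Cv | by rewrite divr_ge0// ltW |].
  by rewrite ler_pdivrMr// mul1r lerDl.
rewrite scalerDr !scalerA mulrC divfK ?gt_eqF//; congr (_ + _ *: _).
by field; rewrite gt_eqF.
Qed.

Definition slope g (a b : R) := (b - a)^-1 *: (g b - g a).

Lemma slopeC g a b : slope g a b = slope g b a.
Proof.
by rewrite /slope -(opprB a b) invrN scaleNr -scalerN opprB.
Qed.

Lemma convex_slope C g (a s b : R) : convex C -> a < s -> s < b ->
  C (slope g a s) -> C (slope g s b) -> C (slope g a b).
Proof.
move=> cC ms sb C1 C2; have ab := lt_trans ms sb.
have -> : slope g a b = ((s - a) / (b - a)) *: slope g a s +
    (1 - (s - a) / (b - a)) *: slope g s b.
  rewrite /slope !scalerA.
  have -> : (s - a) / (b - a) * (s - a)^-1 = (b - a)^-1.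
    by field; rewrite !subr_eq0 !gt_eqF.
  have -> : (1 - (s - a) / (b - a)) * (b - s)^-1 = (b - a)^-1.
    by field; rewrite !subr_eq0 !gt_eqF.
  by rewrite -scalerDr [g s - g a + _]addrC addrA subrK.
apply: cC => //; first by rewrite divr_ge0// subr_ge0 ltW.
by rewrite ler_pdivrMr ?subr_gt0// mul1r lerD2r ltW.
Qed.

Lemma derive_slope C g (t : R) (v : F) : open C -> C v ->
  h^-1 *: (g (t + h) - g t) @[h --> (0 : R)^'] --> v ->
  exists2 e, 0 < e & forall s, s != t -> `|s - t| < e -> C (slope g t s).
Proof.
move=> oC Cv /(_ C (open_nbhs_nbhs (conj oC Cv))) [e /= e0 H].
exists e => // s st ste; rewrite /slope.
have := H (s - t); rewrite /= [t + _]addrC subrK; apply.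
  by rewrite sub0r normrN.
by rewrite subr_eq0.
Qed.

(* The points [s] whose slope from [a] lies in [C] reach up to [b], since [C]
   is open and the slope over a union of adjacent intervals is a convex
   combination of the two slopes. *)
Lemma convex_MVT C g (dg : R -> F) (a b : R) : a < b -> open C -> convex C ->
  (forall t, a <= t <= b ->
    h^-1 *: (g (t + h) - g t) @[h --> (0 : R)^'] --> dg t) ->
  (forall t, a <= t <= b -> C (dg t)) ->
  C (slope g a b).
Proof.
move=> ab oC cC gd Cd.
have loc t : a <= t <= b -> exists2 e, 0 < e &
    forall s, s != t -> `|s - t| < e -> C (slope g t s).
  by move=> tab; exact: derive_slope oC (Cd t tab) (gd t tab).
pose A := [set s | a < s <= b /\ C (slope g a s)].
have [|e e0 He] := loc a; first by rewrite lexx ltW.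
have A0 : A !=set0.
  exists (Num.min b (a + e / 2)).
  have ma : a < Num.min b (a + e / 2) by rewrite lt_min ab ltrDl divr_gt0.
  split; first by rewrite ma ge_min lexx.
  apply: He; first by rewrite gt_eqF.
  rewrite gtr0_norm ?subr_gt0// ltrBlDl gt_min; apply/orP; right.
  by rewrite ltrD2l gtr_pMr// invf_lt1// ltr1n.
have ubA : ubound A b by move=> s [/andP[]].
have supA : has_sup A by split=> //; exists b.
set t := sup A.
have tb : t <= b by apply: ge_sup.
have at_ : a < t.
  have [s As] := A0; have [/andP[as_ _] _] := As.
  by apply: (lt_le_trans as_); apply: sup_upper_bound.
have [|d d0 Hd] := loc t; first by rewrite (ltW at_).
(* The supremum is attained: a point [s] of [A] close to [t] has its slope to [t] in [C], and this
   is joined to the slope from [a] to [s]. *)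
have At : C (slope g a t).
  have [s As ts] := sup_adherent d0 supA.
  have st : s <= t by apply: sup_upper_bound.
  move: st; rewrite le_eqVlt => /predU1P[e1|st]; first by rewrite -e1; case: As.
  have [/andP[as_ _] Cs] := As.
  apply: (@convex_slope C g a s t) => //; rewrite slopeC.
  apply: Hd; first by rewrite lt_eqF.
  by rewrite ltr0_norm ?subr_lt0// opprB ltrBlDl -ltrBlDr.
move: tb; rewrite le_eqVlt => /predU1P[<-//|tb].
(* If [t < b], the local property at [t] also gives a point of [A] beyond the supremum, a
   contradiction. *)
pose u := Num.min b (t + d / 2).
have tu : t < u by rewrite lt_min tb ltrDl divr_gt0.
have : A u.
  split; first by rewrite (lt_trans at_ tu) /u ge_min lexx.
  apply: (@convex_slope C g a t u) => //; apply: Hd; first by rewrite gt_eqF.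
  rewrite gtr0_norm ?subr_gt0// ltrBlDl gt_min; apply/orP; right.
  by rewrite ltrD2l gtr_pMr// invf_lt1// ltr1n.
by move=> /(sup_upper_bound supA); rewrite leNgt tu.
Qed.

End ConvexMVT.

(** * Iterated difference quotients on cubes *)

Section Differences.
Context {R : realType} {d : nat} {F : lcsType R}.
Implicit Types (C : set F) (g : 'rV[R]_d -> F) (x y : 'rV[R]_d) (h rho : R).
Implicit Types (i : 'I_d) (w : seq 'I_d).

Definition cube x rho : set 'rV[R]_d := [set y | forall j, `|y 0 j - x 0 j| < rho].

(** Backward differences are the ones that arise when summation by parts moves a forward shift of
    the splines onto the samples. *)
Definition nabla h i g y : F := h^-1 *: (g y - g (y - h *: delta_mx 0 i)).

Definition nablas h w g := foldr (nabla h) g w.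

Lemma subrACA (V : zmodType) (a b c e : V) : a - b - (c - e) = a - c - (b - e).
Proof. by rewrite !opprB addrACA [RHS]addrACA [- b - c]addrC. Qed.

Lemma cvg_eqfun (T : Type) (G : set_system T) (f g : T -> F) (a b : F) :
  f @ G --> a -> f =1 g -> a = b -> g @ G --> b.
Proof. by move=> fa /funext <- <-. Qed.

Lemma nablaC h i j g : nabla h i (nabla h j g) = nabla h j (nabla h i g).
Proof.
apply/funext => y; rewrite /nabla -!scalerBr; congr (_ *: (_ *: _)).
by rewrite subrACA [y - h *: delta_mx 0 i - _]addrAC.
Qed.

(** Used to let an induction on the word apply its first letter directly to the function. *)
Lemma nablas_nabla h i w g : nablas h w (nabla h i g) = nabla h i (nablas h w g).
Proof. by elim: w => //= j w ->; rewrite nablaC. Qed.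

Lemma cube_step x rho h i y t : cube x (rho - h) y -> `|t| <= h ->
  cube x rho (y + t *: delta_mx 0 i).
Proof.
move=> xy th j; rewrite !mxE /= addrAC.
apply: (le_lt_trans (ler_normD _ _)); have := xy j; rewrite ltrBrDr.
apply: le_lt_trans; rewrite lerD2l; apply: le_trans th.
by case: (j == i); rewrite ?mulr1 ?mulr0 ?normr0.
Qed.

(** Each difference reaches a distance [h] along one axis, so a word costs [h * size w] of the
    radius. *)
Lemma nablas_eq_on h w f g x rho : 0 <= h ->
  (forall y, cube x rho y -> f y = g y) ->
  forall y, cube x (rho - h * (size w)%:R) y -> nablas h w f y = nablas h w g y.
Proof.
move=> h0; elim: w rho f g => [|i w IH] rho f g fg y /=.
  by rewrite mulr0 subr0 => /fg.
move=> xy; rewrite -!nablas_nabla; apply: (IH (rho - h)).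
  move=> z xz; rewrite /nabla !fg//.
    by rewrite -scaleNr; apply: (cube_step i xz); rewrite normrN ger0_norm.
  by have := cube_step i xz (_ : `|0| <= h); rewrite scale0r addr0 normr0; apply.
by move: xy; rewrite -addrA -opprD -[(size w).+1]add1n natrD mulrDr mulr1.
Qed.

(* Iterated mean value theorem; [G v] plays the part of the [v]-th derivative
   of [G [::]]. *)
Lemma nablas_mem C h w (G : seq 'I_d -> 'rV[R]_d -> F) x rho :
  0 < h -> open C -> convex C ->
  (forall v0 i v, w = v0 ++ i :: v -> forall y, cube x rho y ->
    t^-1 *: (G v (y + t *: delta_mx 0 i) - G v y) @[t --> (0 : R)^'] -->
      G (i :: v) y) ->
  (forall y, cube x rho y -> C (G w y)) ->
  forall y, cube x (rho - h * (size w)%:R) y -> C (nablas h w (G [::]) y).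
Proof.
move=> h0 oC cC; elim: w G rho => [|i w IH] G rho dG CG y /=.
  by rewrite mulr0 subr0 => /CG.
move=> xy; rewrite -nablas_nabla.
(* By linearity the differences [nabla h i (G v)] again form a family of successive derivatives, now
   along [w] and on a cube smaller by [h]. *)
apply: (IH (fun v => nabla h i (G v)) (rho - h)) => [v0 j v wE z xz|z xz|].
- have xz0 : cube x rho z.
    have := cube_step i xz (_ : `|0| <= h).
    by rewrite scale0r addr0 normr0 => /(_ (ltW h0)).
  have xz1 : cube x rho (z - h *: delta_mx 0 i).
    by rewrite -scaleNr; apply: (cube_step i xz); rewrite normrN gtr0_norm.
  have c1 := dG (i :: v0) j v _ _ xz0; rewrite wE in c1.
  have c2 := dG (i :: v0) j v _ _ xz1; rewrite wE in c2.
  have := @cvg_lincomb R F R _ (dnbhs_filter 0) (-1) _ _ _ _ (c2 erefl) (c1 erefl).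
  move=> /(@cvg_lincomb R F R _ (dnbhs_filter 0) h^-1 _ (cst 0) _ 0)/(_ (cvg_cst _)).
  move=> H; apply: (cvg_eqfun H) => [t|] /=; last first.
    by rewrite addr0 scaleN1r [- _ + _]addrC.
  rewrite /cst addr0 scaleN1r [- _ + _]addrC /nabla -!scalerBr.
  rewrite scalerA mulrC -scalerA; congr (_ *: (_ *: _)).
  by rewrite subrACA [z + _ - _]addrAC.
(* A single difference is a slope along a segment of length [h], to which the one-variable mean
   value theorem applies. *)
- have -> : nabla h i (G w) z =
      slope (fun t => G w (z - h *: delta_mx 0 i + t *: delta_mx 0 i)) 0 h.
    by rewrite /slope subr0 scale0r addr0 subrK.
  have cz t : 0 <= t <= h -> cube x rho (z - h *: delta_mx 0 i + t *: delta_mx 0 i).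
    move=> /andP[t0 th]; rewrite -addrA -scaleNr -scalerDl; apply: (cube_step i xz).
    by rewrite ler0_norm; lra.
  apply: (convex_MVT h0 oC cC) => [t th|t th]; last exact: CG (cz t th).
  have := dG [::] i w erefl _ (cz t th).
  move=> H; apply: (cvg_eqfun H) => // s /=.
  by rewrite scalerDl addrA.
- by move: xy; rewrite -addrA -opprD -[(size w).+1]add1n natrD mulrDr mulr1.
Qed.

End Differences.

(** * The sampling operators *)

Section SeparateVariables.
Context {R : realType} {d : nat} {Omega : set 'rV[R]_d} {F : lcsType R}.

Lemma valL_val (f : Omega -> F) (x : Omega) : 'valL_0 f (set_val x) = f x.
Proof. exact: (congr1 (@^~ x) (valLK 0 f)). Qed.

Lemma valL_restrict (f : 'rV[R]_d -> F) (y : 'rV[R]_d) : Omega y ->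
  'valL_0 (fun x : Omega => f (set_val x)) y = f y.
Proof.
move=> Oy; have -> : y = set_val (exist _ y (mem_set Oy) : Omega) by [].
by rewrite valL_val.
Qed.

Lemma cvg_scaler (T : Type) (G : set_system T) (FG : Filter G) (c : T -> R)
    (v : T -> F) (a : R) (b : F) :
  c @ G --> a -> v @ G --> b -> (fun t => c t *: v t) @ G --> a *: b.
Proof.
move=> ca vb.
have cv : (fun t => (c t : R^o, v t)) @ G --> ((a : R^o), b)
  by exact: (@cvg_pair _ _ _ G (nbhs (a : R^o)) (nbhs b)).
apply: (@cvg_comp _ _ _ (fun t => (c t : R^o, v t))
  (fun z : R^o * F => z.1 *: z.2) G (nbhs ((a : R^o), b)) _ cv).
exact: (@scale_continuous R F ((a : R^o), b)).
Qed.

Lemma cvg_sumr (T I : Type) (G : set_system T) (FG : Filter G) (r : seq I)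
    (v : I -> T -> F) (a : I -> F) :
  (forall k, v k @ G --> a k) ->
  (fun t => \sum_(k <- r) v k t) @ G --> \sum_(k <- r) a k.
Proof.
move=> va; elim: r => [|k r IH].
  rewrite big_nil; under eq_fun do rewrite big_nil.
  exact: cvg_cst.
rewrite big_cons; under eq_fun do rewrite big_cons.
have := @cvg_lincomb R F T G FG 1 _ _ _ _ (va k) IH.
by rewrite scale1r; under eq_fun do rewrite scale1r.
Qed.

(** Sums of this shape are stable under partial derivatives, which only change one factor of each
    product and keep the vectors [v k]. *)
Definition sepfun (I : Type) (r : seq I) (u : I -> 'I_d -> R -> R) (v : I -> F)
    (y : 'rV[R]_d) : F :=
  \sum_(k <- r) (\prod_i u k i (y 0 i)) *: v k.

(** Vectors and evaluation point vary together: this gives continuity in the point and, later,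
    continuity of the operator. *)
Lemma sepfun_cvg (T I : Type) (G : set_system T) (FG : Filter G) (r : seq I)
    (u : I -> 'I_d -> R -> R) (v : T -> I -> F) (v0 : I -> F)
    (X : T -> 'rV[R]_d) (x : 'rV[R]_d) :
  (forall k i, continuous (u k i)) -> (forall k, v t k @[t --> G] --> v0 k) ->
  X @ G --> x -> (fun t => sepfun r u (v t) (X t)) @ G --> sepfun r u v0 x.
Proof.
move=> cu vv0 Xx; apply: cvg_sumr => k; apply: cvg_scaler; last exact: vv0.
apply: cvg_big => [|i _]; first exact: mul_continuous.
apply: (@cvg_comp _ _ _ (fun t => X t 0 i) (u k i) G (nbhs (x 0 i))); last exact: cu.
apply: (@cvg_comp _ _ _ X (fun y => y 0 i) G (nbhs x)) => //.
exact: coord_continuous.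
Qed.

Lemma derive1_cvg (f : R -> R) (x : R) : derivable f x 1 ->
  h^-1 * (f (x + h) - f x) @[h --> (0 : R)^'] --> derive1 f x.
Proof.
move=> df.
have e : (fun h => h^-1 * (f (x + h) - f x)) =
    (fun h => h^-1 *: ((f \o shift x) (h *: (1 : R)) - f x)).
  by apply/funext => h; rewrite /= [h *: _]mulr1 [h + x]addrC.
rewrite derive1E e; exact: df.
Qed.

Lemma nbhs_cubeP (x : 'rV[R]_d) (A : set 'rV[R]_d) :
  nbhs x A <-> exists2 rho, 0 < rho & cube x rho `<=` A.
Proof.
split=> [/nbhs_ballP[rho rho0 xA]|[rho rho0 xA]].
  exists rho => // y xy; apply: xA; split=> // i j.
  by rewrite (ord1 i) /ball /= distrC; exact: xy.
apply/nbhs_ballP; exists rho => // y [_ xy]; apply: xA => j.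
by rewrite distrC; exact: xy.
Qed.

Lemma near_Omega (i : 'I_d) (x : Omega) : open Omega ->
  \forall h \near (0 : R)^', Omega (set_val x + h *: delta_mx 0 i).
Proof.
move=> oO; have : nbhs (set_val x) Omega.
  by apply: open_nbhs_nbhs; split => //; exact: set_valP.
move=> /nbhs_cubeP[rho rho0 xO]; exists rho => //= h; rewrite /= sub0r normrN => hr _.
apply: xO; have := @cube_step _ _ (set_val x) rho `|h| i (set_val x) h _ (lexx _).
by apply=> j; rewrite subrr normr0 subr_gt0.
Qed.

Lemma prod_step (u : 'I_d -> R -> R) (i : 'I_d) (y : 'rV[R]_d) (h : R) :
  \prod_j u j ((y + h *: delta_mx 0 i) 0 j) =
  (\prod_(j | j != i) u j (y 0 j)) * u i (y 0 i + h).
Proof.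
rewrite (bigD1 i)//= mulrC !mxE !eqxx mulr1; congr (_ * _).
by apply: eq_bigr => j /negbTE ji; rewrite !mxE ji andbF mulr0 addr0.
Qed.

Lemma pderiv_sepfun (I : Type) (r : seq I) (u : I -> 'I_d -> R -> R) (v : I -> F)
   (i : 'I_d) (x : Omega) : open Omega -> (forall k j, smooth (u k j)) ->
  diff_quotient (fun x : Omega => sepfun r u v (set_val x)) i x h @[h --> 0^'] -->
  sepfun r (fun k j => if j == i then derive1 (u k j) else u k j) v (set_val x).
Proof.
move=> oO su.
pose q k h := h^-1 * (u k i (set_val x 0 i + h) - u k i (set_val x 0 i)).
(* For small [h] the shifted point stays in [Omega], so the zero extension is not met, and only the
   [i]-th factor changes. *)
apply: (@cvg_trans _ ((fun h => \sum_(k <- r)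
  (\prod_(j | j != i) u k j (set_val x 0 j) * q k h) *: v k) @ 0^')).
  apply: near_eq_cvg; near=> h; rewrite /diff_quotient valL_restrict; last first.
    by near: h; exact: near_Omega.
  rewrite /sepfun -sumrB scaler_sumr; apply: eq_bigr => k _.
  rewrite -scalerBl scalerA; congr (_ *: _).
  have := prod_step (u k) i (set_val x) 0; rewrite scale0r !addr0 => ->.
  by rewrite prod_step -mulrBr mulrCA.
apply: cvg_sumr => k; apply: cvg_scaler; last exact: cvg_cst.
rewrite [X in _ --> X](bigD1 i)//= eqxx mulrC; apply: cvgM; last first.
  by apply: derive1_cvg; have [] := smooth_is_derive (set_val x 0 i) (su k i).
rewrite [X in _ --> X](eq_bigr (fun j => u k j (set_val x 0 j))).
  exact: cvg_cst.
by move=> j /negbTE ->.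
Unshelve. all: by end_near. Qed.

(** Joint convergence gives, at each point of a compact set, a neighbourhood on which one element of
    [G] works; compactness leaves finitely many of these. *)
Lemma compact_open_cvg (X Y : topologicalType) (T : Type) (G : set_system T)
    (FG : Filter G) (f : T -> X -> Y) (f0 : X -> Y) :
  (forall x, f p.1 p.2 @[p --> (G, nbhs x)] --> f0 x) ->
  {compact-open, f @ G --> f0}.
Proof.
move=> H; apply/compact_open_cvgP => K O /compact_near_coveringP cK oO f0K.
have : \forall t \near G, K `<=` [set x | O (f t x)].
  apply: (cK _ G (fun t x => O (f t x))) => // x Kx.
  have [[A B] /= [GA xB] AB] : \forall p \near (G, nbhs x), O (f p.1 p.2).
    by apply: (H x); apply: open_nbhs_nbhs; split => //; apply: f0K; exists x.
  by exists (B, A) => // -[y t] [/= By At]; exact: (AB (t, y)).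
by apply: filterS => t Kt _ [x Kx <-]; exact: Kt.
Qed.

End SeparateVariables.

(** * Sampling as a continuous linear map *)

Section SampleOperator.
Context {R : realType} {d : nat} {Omega : set 'rV[R]_d} {F : lcsType R}.
Hypothesis openOmega : open Omega.

Lemma smooth_iter_derive1 n (f : R -> R) : smooth f -> smooth (iter n (@derive1 R R) f).
Proof. by move=> sf; elim: n => //= n; exact: smooth_derive1. Qed.

Lemma pderivs_sepfun (I : Type) (r : seq I) (u : I -> 'I_d -> R -> R) (v : I -> F)
    (w : seq 'I_d) : (forall k j, smooth (u k j)) ->
  pderivables w (fun x : Omega => sepfun r u v (set_val x)) /\
  pderivs w (fun x : Omega => sepfun r u v (set_val x)) =
  (fun x : Omega => sepfun r
    (fun k j => iter (count_mem j w) (@derive1 R R) (u k j)) v (set_val x)).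
Proof.
move=> su; elim: w => [//|i w [IH1 IH2]] /=; rewrite IH2.
set u' := (fun k j => iter (count_mem j w) (@derive1 R R) (u k j)).
have su' k j : smooth (u' k j) by apply: smooth_iter_derive1.
split; first by split => // x; eexists; exact: pderiv_sepfun.
apply/funext => x; apply: pderivP.
rewrite [sepfun _ _ _ _](_ : _ =
  sepfun r (fun k j => if j == i then derive1 (u' k j) else u' k j) v (set_val x)).
  exact: pderiv_sepfun.
apply: eq_bigr => k _; congr (_ *: _); apply: eq_bigr => j _.
by rewrite eq_sym; case: eqP.
Qed.

Lemma is_Ck_sepfun (I : Type) (r : seq I) (u : I -> 'I_d -> R -> R) (v : I -> F) :
  (forall k j, smooth (u k j)) ->
  (fun x : Omega => sepfun r u v (set_val x)) \in Ck_pred None.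
Proof.
move=> su.
have cs w (u' := fun k j => iter (count_mem j w) (@derive1 R R) (u k j)) :
    continuous (fun x : Omega => sepfun r u' v (set_val x)).
  move=> x; apply: (@sepfun_cvg R d F _ I (nbhs x) _ r u' (fun=> v) v).
  - by move=> k j; apply: smooth_continuous; exact: smooth_iter_derive1.
  - by move=> k; exact: cvg_cst.
  - exact: initial_continuous.
apply/asboolP; split; first exact: (cs [::]).
move=> alpha _; have [H1 H2] := @pderivs_sepfun I r u v (mindex_word alpha) su.
by split=> //; rewrite /mpderiv H2; exact: cs.
Qed.

Lemma valL_out (f : Omega -> F) (y : 'rV[R]_d) : ~ Omega y -> 'valL_0 f y = 0.
Proof.
move=> nOy; have /(congr1 (@^~ y)) := congr1 (@^~ ('valL_0 f)) (@sigLK _ F (0 : F) Omega).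
by rewrite /= (valLK 0 f) /restrict /patch memNset.
Qed.

Lemma valL_lincomb (a : R) (f g : Omega -> F) (y : 'rV[R]_d) :
  'valL_0 (a *: f + g) y = a *: 'valL_0 f y + 'valL_0 g y.
Proof.
rewrite /valL_ /=; case: ('oinv_set_val y) => //=.
by rewrite scaler0 addr0.
Qed.

Lemma mindex_word0 : @mindex_word d (fun=> 0%N) = [::].
Proof. by rewrite /mindex_word; elim: (enum _). Qed.

(** The derivative of order 0 is continuous into the compact-open topology, which is tested on the
    singleton of [p]; outside [Omega] the value is constantly 0. *)
Lemma eval_continuous (l : option nat) (p : 'rV[R]_d) (g : 'C^l(Omega, F)) :
  'valL_0 (g' : Omega -> F) p @[g' --> g] --> 'valL_0 (g : Omega -> F) p.
Proof.
have [Op|nOp] := pselect (Omega p); last first.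
  rewrite valL_out//; apply: (cvg_eqfun (cvg_cst (0 : F))) => // g'.
  by rewrite /cst valL_out.
pose x : Omega := exist _ p (mem_set Op).
have e (g' : 'C^l(Omega, F)) : 'valL_0 (g' : Omega -> F) p = g' x.
  exact: (valL_val g' x).
have a0 : le_order (@mdegree d (fun=> 0%N)) l.
  by rewrite /mdegree big1//; case: (l).
have m0 (g' : 'C^l(Omega, F)) :
    @Ck_pderiv_map _ _ l Omega F (exist _ (fun=> 0%N) a0) g' = g'.
  by rewrite /Ck_pderiv_map /mpderiv /= mindex_word0.
rewrite e; suff H : (fun g' : 'C^l(Omega, F) => g' x) @ g --> g x.
  by apply: (cvg_eqfun H) => // g'; rewrite (e g').
pose a00 := exist (fun alpha => le_order (@mdegree d alpha) l) (fun=> 0%N) a0.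
have H1 : nbhs g --> g by [].
have H2 := iffLR (@Ck_cvgP R d l Omega F (nbhs g) g _) H1 a00.
have H3 := iffLR (@compact_open_cvgP _ _ (Ck_pderiv_map a00 @ nbhs g)
  (Ck_pderiv_map a00 g) _) (H2 (nbhs_filter g)).
move=> A; rewrite /= nbhsE => -[B [oB Bg] BA].
have HB : nbhs g [set g' | [set Ck_pderiv_map a00 g' z | z in [set x]] `<=` B].
  apply: (H3 (fmap_filter _ (nbhs_filter g)) [set x] B (@compact_set1 _ x) oB).
  by rewrite m0 => _ [_ -> <-].
apply: (@filterS _ (nbhs g) _ _ _ _ HB) => g' /=.
by rewrite m0 => HB'; apply: BA; apply: HB'; exists x.
Qed.

(** Samples are read through the zero extension, so the points [p k] may lie outside [Omega]. *)
Definition sample_fun (I : Type) (l : option nat) (r : seq I) (u : I -> 'I_d -> R -> R)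
    (p : I -> 'rV[R]_d) (su : forall k j, smooth (u k j)) (g : 'C^l(Omega, F)) :
    'C^oo(Omega, F) :=
  CkSpace (is_Ck_sepfun r (fun k => 'valL_0 (g : Omega -> F) (p k)) su).

Lemma sample_fun_linear I l r u p su : linear (@sample_fun I l r u p su).
Proof.
move=> a f g; apply/val_inj/funext => x /=.
pose vl (f : Omega -> F) k := 'valL_0 f (p k).
change (sepfun r u (vl (a *: (f : Omega -> F) + g)) (set_val x) =
  a *: sepfun r u (vl f) (set_val x) + sepfun r u (vl g) (set_val x)).
rewrite /sepfun scaler_sumr -big_split.
apply: eq_bigr => k _ /=.
by rewrite /vl (valL_lincomb a f g) scalerDr !scalerA mulrC.
Qed.

HB.instance Definition _ I l r u p su :=
  GRing.isLinear.Build R _ _ _ (@sample_fun I l r u p su)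
    (@sample_fun_linear I l r u p su).

(** The image depends on [g] only through finitely many point evaluations, which are continuous. *)
Lemma sample_fun_continuous I l r u p su : continuous (@sample_fun I l r u p su).
Proof.
move=> g.
have FS : Filter (@sample_fun I l r u p su @ nbhs g) by apply: fmap_filter.
apply/Ck_cvgP => alpha; apply: (@compact_open_cvg Omega F _ (nbhs g) _
  (fun g' => mpderiv (sval alpha) (sample_fun r p su g')) _ _) => x.
rewrite /Ck_pderiv_map /mpderiv /=.
have [_ ->] := @pderivs_sepfun I r u (fun k => 'valL_0 (g : Omega -> F) (p k))
  (mindex_word (sval alpha)) su.
pose P := filter_prod (nbhs g) (nbhs x).
have c1 k j : continuous
    (iter (count_mem j (mindex_word (sval alpha))) (@derive1 R R) (u k j)).
  by apply: smooth_continuous; exact: smooth_iter_derive1.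
have c2 k :
    (fun t : 'C^l(Omega, F) * Omega => 'valL_0 (t.1 : Omega -> F) (p k)) @ P -->
    'valL_0 (g : Omega -> F) (p k).
  apply: (@cvg_comp _ _ _ fst
    (fun g' : 'C^l(Omega, F) => 'valL_0 (g' : Omega -> F) (p k)) _ (nbhs g)).
    exact: cvg_fst.
  exact: eval_continuous.
have c3 : (fun t : 'C^l(Omega, F) * Omega => set_val t.2) @ P --> set_val x.
  apply: (@cvg_comp _ _ _ snd (fun x : Omega => set_val x) _ (nbhs x)).
    exact: cvg_snd.
  exact: initial_continuous.
have FP : Filter P by exact: filter_prod_filter.
have H := @sepfun_cvg R d F _ I P FP r _ _ _ _ _ c1 c2 c3.
apply: (cvg_eqfun H) => // t; rewrite /Ck_pderiv_map /mpderiv /=.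
by have [_ ->] := @pderivs_sepfun I r u (fun k => 'valL_0 (t.1 : Omega -> F) (p k))
  (mindex_word (sval alpha)) su.
Qed.

End SampleOperator.

(** * Mesh sizes and supports *)

Section Construction.
Context {R : realType} {d : nat} {Omega : set 'rV[R]_d} {F : lcsType R}.
Hypothesis openOmega : open Omega.
Implicit Types (K : set 'rV[R]_d).

(** If the cube of radius [rho] about [p] lies in [K'], half of [rho] serves all points near [p];
    compactness then makes the radius uniform. *)
Lemma compact_cube_interior K K' : compact K -> K `<=` K'° ->
  exists2 e, 0 < e & forall p, K p -> cube p e `<=` K'.
Proof.
move=> /compact_near_coveringP cK KK'.
have : \forall e \near (0 : R)^'+, K `<=` [set p | cube p e `<=` K'].
  apply: (cK _ _ (fun e p => cube p e `<=` K')) => p /KK' /nbhs_cubeP[rho rho0 pK'].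
  exists (cube p (rho / 2), [set e | e < rho / 2]) => /=.
    split; last by apply: nbhs_right_lt; rewrite divr_gt0.
    by apply/nbhs_cubeP; exists (rho / 2); rewrite ?divr_gt0.
  move=> [q e] [/= pq er] y qy; apply: pK' => j.
  have := pq j; have := qy j; have := ler_distD (q 0 j) (y 0 j) (p 0 j).
  by lra.
move=> He; near (0 : R)^'+ => e; exists e; first by near: e; exact: nbhs_right_gt.
by near: e.
Unshelve. all: by end_near. Qed.

Lemma compact_row_bounded K : compact K ->
  exists M, forall p, K p -> forall j, `|p 0 j| <= M.
Proof.
move=> /compact_near_coveringP cK.
have : \forall M \near +oo, K `<=` [set p : 'rV[R]_d | forall j, `|p 0 j| <= M].
  apply: (cK _ _ (fun M (p : 'rV[R]_d) => forall j, `|p 0 j| <= M)) => p _.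
  pose B := \sum_j `|p 0 j| + 1.
  exists (cube p 1, [set M | B < M]) => /=.
    split; first by apply/nbhs_cubeP; exists 1.
    by apply: nbhs_pinfty_gt; rewrite num_real.
  move=> [q M] [/= pq BM] j.
  have := ler_distD (q 0 j) 0 (p 0 j); have := pq j.
  have : `|p 0 j| <= \sum_j `|p 0 j| by rewrite (bigD1 j)//= lerDl sumr_ge0.
  have := ler_normD (q 0 j - p 0 j) (p 0 j); rewrite subrK; rewrite /B in BM; lra.
by move=> HM; have [M MP] := filter_ex HM; exists M.
Qed.

Definition lattice (h : R) (z : 'rV[int]_d) : 'rV[R]_d :=
  \row_j (h * (z 0 j)%:~R).

(** If [M] bounds the coordinates on [K], the entries of [z] lie between [-N] and [N] with
    [N > M / h]; finite functions shifted by [N] enumerate all candidates. *)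
Lemma lattice_points K h : compact K -> 0 < h -> exists r : seq 'rV[int]_d,
  uniq r /\ forall z, z \in r <-> K (lattice h z).
Proof.
move=> /compact_row_bounded[M KM] h0.
pose N := Num.bound (h^-1 * M).
pose rho (f : {ffun 'I_d -> 'I_(N + N).+1}) : 'rV[int]_d := \row_j ((f j)%:Z - N%:Z).
exists (undup [seq z <- map rho (enum {ffun 'I_d -> 'I_(N + N).+1})
  | `[< K (lattice h z) >]]).
split=> [|z]; first exact: undup_uniq.
rewrite mem_undup mem_filter; split=> [/andP[/asboolP//]|Kz].
apply/andP; split; first exact/asboolP.
have zN j : exists m : 'I_(N + N).+1, z 0 j = m%:Z - N%:Z.
  have := KM _ Kz j; rewrite mxE normrM (gtr0_norm h0) mulrC -ler_pdivlMr// mulrC => zM.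
  have zN : `|z 0 j| < N%:Z.
    rewrite -(ltr_int R) intr_norm; apply: (le_lt_trans zM).
    apply: archi_boundP; exact: le_trans zM.
  have zN0 : 0 <= z 0 j + N%:Z by lia.
  have zNN : (`|(z 0 j + N%:Z)%R|%N < (N + N).+1)%N by lia.
  by exists (Ordinal zNN) => /=; rewrite gez0_abs// addrK.
have /choice[f fP] := zN.
apply/mapP; exists [ffun j => f j]; first by rewrite mem_enum.
by apply/rowP => j; rewrite mxE ffunE fP.
Qed.

(** One mesh size has to serve all [n <= m], so it is kept below finitely many margins [e n]; the
    bound [1/(m + 1)] forces it to 0. *)
Lemma mesh_exists (K : nat -> set 'rV[R]_d) (L : R) : 0 < L ->
  compact_exhaustion Omega K ->
  exists h : nat -> R, forall m, [/\ 0 < h m, h m <= m.+1%:R^-1 &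
    forall n p, (n <= m)%N -> K n p ->
      forall y : 'rV[R]_d, (forall j, `|y 0 j - p 0 j| <= L * h m) -> K n.+1 y].
Proof.
move=> L0 [cK _ KK].
have /choice[e eP] n : exists e, 0 < e /\ forall p, K n p -> cube p e `<=` K n.+1.
  by have [e e0 eP] := compact_cube_interior (cK n) (KK n); exists e.
have ex m : exists h, 0 < h /\ forall n, (n <= m)%N -> h <= e n.
  elim: m => [|m [h [h0 hP]]].
    by exists (e 0%N); split=> [|n]; [have [] := eP 0%N|rewrite leqn0 => /eqP ->].
  exists (Num.min h (e m.+1)); split; first by rewrite lt_min h0; have [] := eP m.+1.
  move=> n; rewrite leq_eqVlt => /predU1P[->|/hP hn]; first by rewrite ge_min lexx orbT.
  by rewrite ge_min hn.
have /choice[h hP] := ex.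
(* Dividing by [L + L] instead of [L] gives the strict inequality that the open cube of radius [e n]
   demands. *)
exists (fun m => Num.min (h m / (L + L)) m.+1%:R^-1) => m; have [h0 he] := hP m.
have LL : 0 < L + L by rewrite addr_gt0.
split; first by rewrite lt_min divr_gt0//= invr_gt0 ltr0n.
  by rewrite ge_min lexx orbT.
move=> n p nm Knp y yp; have [_] := eP n; apply; first exact: Knp.
move=> j; apply: le_lt_trans (yp j) _.
apply: (@le_lt_trans _ _ (L * (h m / (L + L)))).
  by rewrite ler_pM2l// ge_min lexx.
apply: lt_le_trans (he n nm).
by rewrite mulrCA gtr_pMr// ltr_pdivrMr// mul1r ltrDl.
Qed.

Lemma size_mindex_word (alpha : 'I_d -> nat) : size (mindex_word alpha) = mdegree alpha.
Proof.
rewrite /mindex_word /mdegree size_flatten /shape -map_comp sumnE big_map big_enum /=.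
by apply: eq_bigr => i _; rewrite size_nseq.
Qed.

Lemma pderivables_suffix (v0 v : seq 'I_d) (g : Omega -> F) :
  pderivables (v0 ++ v) g -> pderivables v g.
Proof. by elim: v0 => //= i v0 IH [/IH]. Qed.

(** The box of radius [c] about [p] is closed, so a bound where [f] is nonzero passes to the
    closure. *)
Lemma fsupport_le (f : Omega -> R^o) (p : 'rV[R]_d) (c : R) :
  (forall x : Omega, f x != 0 -> forall j, `|set_val x 0 j - p 0 j| <= c) ->
  forall y, fsupport f y -> forall j, `|y 0 j - p 0 j| <= c.
Proof.
move=> fc _ [x cx <-] j; rewrite leNgt; apply/negP => xc.
have : \forall x' \near x, c < `|(set_val x' : 'rV[R]_d) 0 j - p 0 j|.
  have cf : (fun x' : Omega => `|(set_val x' : 'rV[R]_d) 0 j - p 0 j|) @ nbhs x -->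
      `|(set_val x : 'rV[R]_d) 0 j - p 0 j|.
    apply: cvg_norm; apply: cvgB; last exact: cvg_cst.
    apply: (@cvg_comp _ _ _ (fun x : Omega => set_val x)
      (fun y : 'rV[R]_d => y 0 j) _ (nbhs (set_val x))).
      exact: initial_continuous.
    exact: coord_continuous.
  exact: (cvgr_gt _ cf).
move=> /cx [x' [/= fx' cx']].
by have := fc x' fx' j; rewrite leNgt cx'.
Qed.

(** Terms with zero sample are dropped from the sum, so only boxes about nonzero samples must lie in
    [K']. This is what functions supported in a smaller compact set require. *)
Lemma tensor_smooth_sample (l : option nat) (r : seq 'rV[int]_d)
    (u : 'rV[int]_d -> 'I_d -> R -> R) (p : 'rV[int]_d -> 'rV[R]_d)
    (su : forall z j, smooth (u z j)) (c : R) (K' : set 'rV[R]_d) (g : 'C^l(Omega, F)) :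
  (forall z j t, u z j t != 0 -> `|t - p z 0 j| <= c) ->
  (forall z, z \in r -> 'valL_0 (g : Omega -> F) (p z) != 0 ->
    forall y : 'rV[R]_d, (forall j, `|y 0 j - p z 0 j| <= c) -> K' y) ->
  tensor_smooth K' (sample_fun openOmega r p su g).
Proof.
move=> uc rK'.
pose v z := 'valL_0 (g : Omega -> F) (p z).
(* The scalar bump is itself a one-term separated sum, with value space [R^o] and vector 1. *)
pose W z := CkSpace (is_Ck_sepfun openOmega [:: z] (fun=> 1 : R^o) su).
have WE z x : W z x = \prod_j u z j (set_val x 0 j) :> R.
  by rewrite /W /= /sepfun big_seq1 [_ *: _]mulr1.
exists [seq (1, (fun x => W z x *: v z) : Omega -> F) | z <- r & v z != 0]; split.
  move=> q /mapP[z]; rewrite mem_filter => /andP[vz zr] -> /=.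
  exists (v z), (W z); split=> // y Wy; apply: (rK' z zr vz) => j.
  apply: (fsupport_le _ Wy) => x Wx i.
  have /prodf_neq0 W0 : \prod_j u z j (set_val x 0 j) != 0 by rewrite -(WE z x).
  exact: uc (W0 i isT).
apply/funext => x; rewrite big_map big_filter fct_sumE.
change (sepfun r u v (set_val x) =
  \sum_(z <- r | v z != 0) (1 *: ((fun x => W z x *: v z) : Omega -> F)) x).
rewrite /sepfun [RHS]big_mkcond; apply: eq_bigr => z _.
case: ifPn => [_|/negPn/eqP ->]; last by rewrite scaler0.
by rewrite scale1r -(WE z x).
Qed.

Lemma nbhs_sub_cube (x : Omega) (A : set Omega) : nbhs x A ->
  exists2 rho, 0 < rho &
    forall y : Omega, cube (set_val x) rho (set_val y) -> A y.
Proof.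
move=> [B [[C oC <-]] Cx CA].
have /nbhs_cubeP[rho rho0 xC] : nbhs (set_val x) C by apply: open_nbhs_nbhs.
by exists rho => // y /xC; exact: CA.
Qed.

End Construction.

Lemma floor_sub_ord (R : realType) (t : R) (q : int) (m N : nat) :
  0 < t - q%:~R < m%:R -> (m <= N)%N ->
  exists k : 'I_N, q = Num.floor t - k%:Z.
Proof.
move=> /andP[t0 tm] mN.
have fq : q <= Num.floor t by rewrite floor_ge_int; lra.
have fN : (`|Num.floor t - q|%N < N)%N.
  rewrite -ltz_nat gez0_abs ?subr_ge0// -(ltr_int R) intrB.
  have mN' : m%:R <= N%:R :> R by rewrite ler_nat.
  have := floor_le t; rewrite -pmulrn; lra.
by exists (Ordinal fN) => /=; rewrite gez0_abs ?subr_ge0// subKr.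
Qed.

(** * Summation by parts and convergence *)

Section LatticeSums.
Context {R : realType} {d : nat} {Omega : set 'rV[R]_d} {F : lcsType R}.
Hypothesis openOmega : open Omega.
Variables (phi : nat -> R -> R).
Hypothesis smooth_phi : forall k, smooth (phi k).
Hypothesis phi_ge0 : forall k t, 0 <= phi k t.
Hypothesis phi_supp : forall k t, phi k t != 0 -> 0 < t < k.+2%:R.
Hypothesis phi_deriv : forall k (t : R),
  is_derive t (1 : R) (phi k.+1) (phi k t - phi k (t - 1)).
Hypothesis phi_sum1 : forall k s N, 0 <= s < 1 -> (k.+2 <= N)%N ->
  \sum_(j < N) phi k (s + j%:R) = 1.
Implicit Types (h : R) (k : 'I_d -> nat) (z : 'rV[int]_d) (i j : 'I_d).
Implicit Types (b : 'rV[R]_d -> F) (r : seq 'rV[int]_d).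

(** [k j] is the spline level in direction [j]; it drops by 1 with each derivative in that
    direction. *)
Definition spline h k z j (t : R) : R := phi (k j) (h^-1 * t - (z 0 j)%:~R).

Definition lattice_sum h k r b := sepfun r (spline h k) (fun z => b (lattice h z)).

(** Such a list carries all nonzero samples, so by [sum_covers] it can be exchanged for any other
    one without repetitions. *)
Definition covers h b r := forall z, z \notin r -> b (lattice h z) = 0.

Lemma smooth_spline h k z j : smooth (spline h k z j).
Proof. exact: smooth_affine. Qed.

Lemma sum_covers (I : choiceType) (r1 r2 : seq I) (f : I -> F) :
  uniq r1 -> uniq r2 -> (forall z : I, z \notin r1 -> f z = 0) ->
  (forall z : I, z \notin r2 -> f z = 0) ->
  \sum_(z <- r1) f z = \sum_(z <- r2) f z.
Proof.
move=> u1 u2 c1 c2.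
by rewrite (bigfs _ u1) ?(bigfs _ u2) // => z _; [exact: c2 | exact: c1].
Qed.

Lemma lattice_step h z i : lattice h (z + delta_mx 0 i) = lattice h z + h *: delta_mx 0 i.
Proof.
by apply/rowP => j; rewrite !mxE intrD mulrDr; case: (_ && _).
Qed.

(* Truncated subtraction; only used when [0 < k i]. *)
Definition pred_at i k j := (k j - (j == i))%N.

Lemma derive1_spline h k z i t : (0 < k i)%N ->
  derive1 (spline h k z i) t =
  h^-1 * (spline h (pred_at i k) z i t - spline h (pred_at i k) (z + delta_mx 0 i) i t).
Proof.
move=> ki; rewrite /spline /pred_at eqxx subn1.
case: (k i) ki => // m _ /=.
have := @is_derive_affine _ (phi m.+1) h^-1 (- (z 0 i)%:~R) t _ (phi_deriv _ _).
move=> H; rewrite derive1E; case: H => _ ->.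
by rewrite !mxE !eqxx intrD opprD addrA.
Qed.

(* Summation by parts in the [i]-th coordinate. *)
Lemma lattice_sum_derive h k r b i : (0 < k i)%N -> uniq r -> covers h b r ->
  exists r', [/\ uniq r', covers h (nabla h i b) r' & forall y,
    sepfun r (fun z j => if j == i then derive1 (spline h k z j) else spline h k z j)
      (fun z => b (lattice h z)) y =
    lattice_sum h (pred_at i k) r' (nabla h i b) y].
Proof.
move=> ki ur cr.
pose sh z : 'rV[int]_d := z + delta_mx 0 i.
have shI : injective sh by apply: addIr.
(* The difference [nabla h i b] may be nonzero at points of [r] and at their translates by one
   step. *)
pose r' := undup (r ++ map sh r).
have latB z : lattice h z - h *: delta_mx 0 i = lattice h (z - delta_mx 0 i).
  by rewrite -[in LHS](subrK (delta_mx 0 i) z) lattice_step addrK.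
have c1 z : z \notin r' -> b (lattice h z) = 0.
  by rewrite mem_undup mem_cat negb_or => /andP[/cr].
have c2 z : z \notin r' -> b (lattice h (z - delta_mx 0 i)) = 0.
  rewrite mem_undup mem_cat negb_or => /andP[_ zr]; apply: cr.
  by apply: contra zr => zr; apply/mapP; exists (z - delta_mx 0 i); rewrite // /sh subrK.
exists r'; split; first exact: undup_uniq.
  by move=> z zr; rewrite /nabla latB c1// c2// subrr scaler0.
move=> y.
pose W z := \prod_j spline h (pred_at i k) z j (y 0 j).
have WE z : \prod_j (if j == i then derive1 (spline h k z j) else spline h k z j) (y 0 j)
    = h^-1 * (W z - W (sh z)).
  rewrite /W (bigD1 i)//= eqxx derive1_spline// -mulrA; congr (_ * _).
  rewrite [X in _ = X - _](bigD1 i)//= [X in _ = _ - X](bigD1 i)//= mulrBl.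
  congr (_ * _ - _ * _).
    by apply: eq_bigr => j /negbTE ji; rewrite ji /spline /pred_at ji subn0.
  apply: eq_bigr => j /negbTE ji.
  by rewrite ji /spline /pred_at ji subn0 /sh !mxE ji andbF addr0.
rewrite /lattice_sum /sepfun.
under eq_bigr do rewrite WE -scalerA scalerBl.
rewrite -scaler_sumr sumrB.
under [in RHS]eq_bigr do rewrite /nabla latB scalerA mulrC -scalerA scalerBr.
rewrite -scaler_sumr sumrB; congr (_ *: (_ - _)).
  apply: sum_covers => //; first exact: undup_uniq.
    by move=> z /cr ->; rewrite scaler0.
  by move=> z /c1 ->; rewrite scaler0.
(* Reindexing by [sh] moves the shift from the weights to the samples, which produces the backward
   difference. *)
have -> : \sum_(z <- r) W (sh z) *: b (lattice h z) =
    \sum_(z <- map sh r) W z *: b (lattice h (z - delta_mx 0 i)).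
  by rewrite big_map; apply: eq_bigr => z _; rewrite /sh addrK.
apply: sum_covers; [by rewrite map_inj_uniq | exact: undup_uniq | |].
  move=> z zr; rewrite cr ?scaler0//.
  by apply: contra zr => zr; apply/mapP; exists (z - delta_mx 0 i); rewrite // /sh subrK.
by move=> z /c2 ->; rewrite scaler0.
Qed.

(** One summation by parts per letter; the bound on the counts keeps every level nonnegative, so no
    truncated subtraction occurs. *)
Lemma pderivs_lattice_sum h k r b w : (forall j, count_mem j w <= k j)%N ->
  uniq r -> covers h b r ->
  exists r', [/\ uniq r', covers h (nablas h w b) r' &
    pderivs w (fun x : Omega => lattice_sum h k r b (set_val x)) =
    (fun x : Omega => lattice_sum h (fun j => k j - count_mem j w)%N r' (nablas h w b)
      (set_val x))].
Proof.
move=> + ur cr; elim: w => [|i w IH] kw.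
  exists r; split => //=; apply/funext => x.
  by congr lattice_sum; apply/funext => j; rewrite subn0.
have [|r1 [ur1 cr1 E1]] := IH.
  by move=> j; apply: leq_trans (kw j) => /=; rewrite leq_addl.
have [|r2 [ur2 cr2 E2]] := @lattice_sum_derive h
    (fun j => k j - count_mem j w)%N r1 _ i _ ur1 cr1.
  by have := kw i; rewrite /= eqxx subn_gt0 add1n.
exists r2; split=> //=; rewrite E1; apply/funext => x.
transitivity (sepfun r1 (fun z j => if j == i
    then derive1 (spline h (fun j => k j - count_mem j w)%N z j)
    else spline h (fun j => k j - count_mem j w)%N z j)
  (fun z => nablas h w b (lattice h z)) (set_val x)).
  apply: pderivP; apply: pderiv_sepfun => // z j; exact: smooth_spline.
rewrite E2; congr lattice_sum; apply/funext => j.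
by rewrite /pred_at -subnDA addnC eq_sym.
Qed.

(** The weights are nonnegative and sum to 1, being products of one-dimensional partitions of unity,
    so the sum is a convex combination of samples in [C]. *)
Lemma convex_lattice_sum (C : set F) h k r b (y : 'rV[R]_d) (p0 : F) : convex C -> C p0 ->
  uniq r -> covers h b r ->
  (forall z, (forall j, 0 < h^-1 * y 0 j - (z 0 j)%:~R < (k j).+2%:R) ->
    C (b (lattice h z))) ->
  C (lattice_sum h k r b y).
Proof.
move=> cC Cp0 ur cr Cb.
(* A spline of level [k j] is nonzero at [t j] only for the indices [floor (t j) - m] with
   [m < k j + 2], so [N] values suffice in every direction. *)
pose N := (\max_j k j).+2.
pose t j := h^-1 * y 0 j.
pose rho (f : {ffun 'I_d -> 'I_N}) : 'rV[int]_d := \row_j (Num.floor (t j) - (f j)%:Z).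
have rhoI : injective rho.
  move=> f g /rowP fg; apply/ffunP => j; have := fg j; rewrite !mxE.
  by move=> /addrI /oppr_inj [] /val_inj.
rewrite /lattice_sum /sepfun.
rewrite (@sum_covers _ _ (map rho (enum {ffun 'I_d -> 'I_N})))//; last 3 first.
- by rewrite map_inj_uniq// enum_uniq.
- by move=> z /cr ->; rewrite scaler0.
- move=> z zr; suff -> : \prod_j spline h k z j (y 0 j) = 0 by rewrite scale0r.
  apply/eqP; apply: contraNT zr => /prodf_neq0 W0; apply/mapP.
  have zj j : exists m : 'I_N, z 0 j = Num.floor (t j) - m%:Z.
    apply: (@floor_sub_ord _ _ _ (k j).+2); last by rewrite !ltnS leq_bigmax.
    by have /phi_supp := W0 j isT.
  have /choice[f fP] := zj.
  exists [ffun j => f j]; first by rewrite mem_enum.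
  by apply/rowP => j; rewrite mxE ffunE fP.
rewrite big_map big_enum /=.
have [||p Cp ->] := @convex_sum R F C _ (index_enum {ffun 'I_d -> 'I_N}) xpredT
   (fun f => \prod_j spline h k (rho f) j (y 0 j))
   (fun f => b (lattice h (rho f))) p0 cC Cp0.
- by move=> f _; apply: prodr_ge0 => j _; exact: phi_ge0.
- move=> f _ /prodf_neq0 W0; apply: Cb => j.
  by have /phi_supp := W0 j isT.
suff -> : \sum_(f : {ffun 'I_d -> 'I_N}) \prod_j spline h k (rho f) j (y 0 j) = 1.
  by rewrite scale1r.
pose G j (m : 'I_N) := phi (k j) (t j - (Num.floor (t j))%:~R + m%:R).
transitivity (\sum_(f : {ffun 'I_d -> 'I_N}) \prod_j G j (f j)).
  apply: eq_bigr => f _; apply: eq_bigr => j _.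
  by rewrite /spline /G mxE intrB opprB addrA addrAC.
(* The sum over the box is a product of one-dimensional sums, each evaluated at the fractional part
   of [t j]. *)
rewrite -bigA_distr_bigA big1// => j _; apply: phi_sum1.
  by have := floor_itv (t j); rewrite intrD => /andP[]; lra.
by rewrite !ltnS; exact: leq_bigmax.
Qed.

(** Of the lost radius, [(l + 2) h] bounds the distance from [y] to lattice points of nonzero weight
    and [l h] the reach of at most [l] differences. *)
Lemma mpderiv_sample_mem (l : nat) (g : 'C^(Some l)(Omega, F))
    (alpha : 'I_d -> nat) (C : set F) (K : set 'rV[R]_d) (h rho : R)
    (r : seq 'rV[int]_d) (x y : Omega)
    (su : forall z j, smooth (spline h (fun=> l) z j)) :
  (mdegree alpha <= l)%N -> open C -> convex C -> 0 < h ->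
  K `<=` Omega -> uniq r -> (forall z, z \in r <-> K (lattice h z)) ->
  cube (set_val x) rho `<=` K ->
  (forall y : Omega, cube (set_val x) rho (set_val y) -> C (mpderiv alpha g y)) ->
  cube (set_val x) (rho - (l.+2 + l)%:R * h) (set_val y) ->
  C (mpderiv alpha (sample_fun openOmega r (lattice h) su g) y).
Proof.
move=> al oC cC h0 KO ur rK xK gC xy.
pose w := mindex_word alpha.
have wl : (size w <= l)%N by rewrite size_mindex_word.
have /asboolP[_ /(_ alpha al)[dg _]] := Ck_funP g.
(* Cutting [g] off outside [K] makes [r] carry all nonzero samples; on the cube about [x] nothing
   changes, so the differences there are those of [g]. *)
pose b p : F := if `[< K p >] then 'valL_0 (g : Omega -> F) p else 0.
have cb : covers h b r.
  move=> z zr; rewrite /b; case: asboolP => // /(rK z).2.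
  by rewrite (negbTE zr).
have -> : (sample_fun openOmega r (lattice h) su g : Omega -> F) =
    (fun x : Omega => lattice_sum h (fun=> l) r b (set_val x)).
  apply/funext => z; rewrite /sample_fun /lattice_sum /sepfun /=.
  apply: eq_big_seq => k kr; congr (_ *: _).
  by rewrite /b asboolT//; exact: (rK k).1.
have cnt j : (count_mem j w <= l)%N by apply: leq_trans wl; exact: count_size.
rewrite /mpderiv -/w.
have [r' [ur' cr' ->]] := pderivs_lattice_sum cnt ur cb.
pose G v : 'rV[R]_d -> F := 'valL_0 (pderivs v g).
have CG p : cube (set_val x) (rho - h * (size w)%:R) p -> C (nablas h w b p).
  move=> xp.
  rewrite (@nablas_eq_on _ _ _ h w b (G [::]) (set_val x) rho)//; first last.
  - by move=> q xq; rewrite /b asboolT//; exact: xK.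
  - exact: ltW.
  apply: (nablas_mem h0 oC cC _ _ xp) => [v0 i v wE q xq|q xq].
    have Oq := KO _ (xK _ xq).
    pose q' : Omega := exist _ q (mem_set Oq).
    have [_ /(_ q')[e dgq]] : pderivables (i :: v) (g : Omega -> F).
      by apply: (@pderivables_suffix _ _ _ _ v0); rewrite -wE.
    have -> : G (i :: v) q = e.
      by rewrite /G (valL_val (pderivs (i :: v) g) q') /= (pderivP dgq).
    apply: (cvg_eqfun dgq) => // t.
    have Gq : G v q = pderivs v g q' by exact: (valL_val (pderivs v g) q').
    by rewrite Gq.
  have Oq := KO _ (xK _ xq).
  pose q' : Omega := exist _ q (mem_set Oq).
  have -> : G w q = pderivs w g q' by exact: (valL_val (pderivs w g) q').
  exact: gC.
have widen : rho - (l.+2 + l)%:R * h <= rho - h * (size w)%:R.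
  rewrite lerD2l lerN2 [_ * h]mulrC ler_pM2l// ler_nat.
  by apply: leq_trans wl _; rewrite leq_addl.
apply: (@convex_lattice_sum C _ _ _ _ _ (nablas h w b (set_val y))) => //.
  by apply: CG => j; apply: lt_le_trans (xy j) widen.
move=> z zP; apply: CG => j.
have /andP[z0 zl] := zP j.
have zl' : h^-1 * set_val y 0 j - (z 0 j)%:~R < l.+2%:R.
  by apply: lt_le_trans zl _; rewrite ler_nat !ltnS leq_subr.
have lE : lattice h z 0 j - set_val y 0 j =
    - (h * (h^-1 * set_val y 0 j - (z 0 j)%:~R)).
  by rewrite mxE mulrBr mulVKf ?gt_eqF// opprB.
have yz : `|lattice h z 0 j - set_val y 0 j| <= h * l.+2%:R.
  by rewrite lE normrN normrM (gtr0_norm h0) (gtr0_norm z0) ler_pM2l// ltW.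
have swl : h * (size w)%:R <= h * l%:R by rewrite ler_pM2l// ler_nat.
have := xy j; rewrite natrD mulrDl -!(mulrC h).
have := ler_distD (set_val y 0 j) (lattice h z 0 j) (set_val x 0 j).
lra.
Qed.

Lemma sample_cvg (l : nat) (K : nat -> set 'rV[R]_d) (h : nat -> R)
    (r : nat -> seq 'rV[int]_d)
    (su : forall m z j, smooth (spline (h m) (fun=> l) z j))
    (g : 'C^(Some l)(Omega, F)) :
  compact_exhaustion Omega K -> (forall m, 0 < h m) ->
  (forall m, h m <= m.+1%:R^-1) ->
  (forall m, uniq (r m) /\ forall z, z \in r m <-> K m (lattice (h m) z)) ->
  smooth_incl (Some l) (sample_fun openOmega (r m) (lattice (h m)) (su m) g)
    @[m --> \oo] --> g.
Proof.
move=> [cK bK iK] h0 h1 rP.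
have KOmega n : K n `<=` Omega by rewrite -bK; exact: bigcup_sup.
have mK n m : (n <= m)%N -> K n `<=` K m.
  elim: m => [|m IH]; first by rewrite leqn0 => /eqP ->.
  rewrite leq_eqVlt => /predU1P[->//|/IH nm] p /nm /iK.
  exact: interior_subset.
apply/Ck_cvgP => -[alpha al].
apply: (@compact_open_cvg Omega F nat \oo _ (fun m => mpderiv alpha
  (sample_fun openOmega (r m) (lattice (h m)) (su m) g)) (mpderiv alpha g)) => x O Ox.
have [C [oC Cx CO cC]] := convex_nbhs Ox.
have /asboolP[_ /(_ alpha al)[_ cg]] := Ck_funP g.
have [rho1 rho10 rho1P] := nbhs_sub_cube (cg x C (open_nbhs_nbhs (conj oC Cx))).
have [n _ /iK /nbhs_cubeP[rho2 rho20 rho2P]] : (\bigcup_n K n) (set_val x).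
  by rewrite bK; exact: set_valP.
pose rho := Num.min rho1 rho2.
have rho0 : 0 < rho by rewrite lt_min rho10.
have rho_1 : rho <= rho1 by rewrite ge_min lexx.
have rho_2 : rho <= rho2 by rewrite ge_min lexx orbT.
(* Half of [rho] bounds the distance from [y] to [x], the other half absorbs the margin of
   [mpderiv_sample_mem]; [n < m] puts the cube of radius [rho] into [K m]. *)
exists ([set m | (n < m)%N /\ (l.+2 + l)%:R * h m <= rho / 2],
  [set y : Omega | cube (set_val x) (rho / 2) (set_val y)]) => /=.
  split.
    pose c : R := (l.+2 + l)%:R.
    exists (maxn n.+1 (Num.bound (c * (2 / rho)))) => // m /=.
    rewrite geq_max => /andP[nm cm]; split=> //.
    have : c * (2 / rho) < m.+1%:R.
      apply: lt_le_trans (archi_boundP _) _; last by rewrite ler_nat leqW.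
      by rewrite mulr_ge0// divr_ge0// ltW.
    rewrite mulrA ltr_pdivrMr// => cr.
    apply: (@le_trans _ _ (c * m.+1%:R^-1)); first by rewrite ler_wpM2l.
    by rewrite ler_pdivrMr ?ltr0n//; lra.
  apply: (initial_continuous (x := x)).
  by apply/nbhs_cubeP; exists (rho / 2); rewrite // divr_gt0.
move=> [m y] [/= [nm hm] xy]; apply: CO.
apply: (@mpderiv_sample_mem l g alpha C (K m) (h m) rho) => //.
- by have [] := rP m.
- by have [] := rP m.
- move=> p xp; apply: (mK _ _ nm); apply: rho2P => j.
  exact: lt_le_trans (xp j) rho_2.
- by move=> p xp; apply: rho1P => j; exact: lt_le_trans (xp j) rho_1.
- by move=> j; apply: lt_le_trans (xy j) _; lra.
Qed.

End LatticeSums.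

(** * Assembly of the operators *)

Theorem theorem1p1 (R : realType) (d : nat) (d_gt0 : (0 < d)%N)
    (Omega : set 'rV[R]_d) (openOmega : open Omega) (F : lcsType R)
    (K : nat -> set 'rV[R]_d) (exhK : compact_exhaustion Omega K)
    (l : nat) :
  exists S : nat -> {linear 'C^(Some l)(Omega, F) -> 'C^oo(Omega, F)},
    [/\ forall n, continuous (S n),
        forall g : 'C^(Some l)(Omega, F),
          smooth_incl (Some l) (S n g) @[n --> \oo] --> g,
        forall (n : nat) (g : 'C^(Some l)(Omega, F)),
          tensor_smooth (K n.+1) (S n g) &
        forall (n m : nat) (g : 'C^(Some l)(Omega, F)),
          (n <= m)%N -> fsupport g `<=` K n ->
          tensor_smooth (K n.+1) (S m g)].
Proof.
have [phi [sphi phi0 phi_supp phi_deriv phi_sum]] := @smooth_splines R.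
(* [phi l] vanishes off an interval of length [l + 2], so a bump extends at most [(l + 2) h m] from
   its lattice point in each direction. *)
have L0 : 0 < l.+2%:R :> R by rewrite ltr0n.
have [h hP] := mesh_exists L0 exhK.
have [cK _ _] := exhK.
have h0 m : 0 < h m by have [] := hP m.
have /choice[r rP] m := lattice_points (cK m) (h0 m).
pose u m := spline phi (h m) (fun=> l) : _ -> 'I_d -> R -> R.
have su m z j : smooth (u m z j) by exact: smooth_spline.
have u_supp m z j t : u m z j t != 0 -> `|t - lattice (h m) z 0 j| <= l.+2%:R * h m.
  move=> /phi_supp /andP[t0 tl]; rewrite mxE.
  have -> : t - h m * (z 0 j)%:~R = h m * ((h m)^-1 * t - (z 0 j)%:~R).
    by rewrite mulrBr mulVKf// gt_eqF.
  by rewrite normrM (gtr0_norm (h0 m)) mulrC ler_pM2r// gtr0_norm// ltW.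
pose S m : {linear 'C^(Some l)(Omega, F) -> 'C^oo(Omega, F)} :=
  @sample_fun R d Omega F openOmega _ (Some l) (r m) (u m) (lattice (h m)) (su m).
exists S; split.
- by move=> n; exact: sample_fun_continuous.
- move=> g; apply: sample_cvg exhK h0 _ rP => // m; by have [] := hP m.
- move=> n g; apply: (tensor_smooth_sample _ _ (u_supp n)) => z /(rP n).2 Kz _ y.
  by have [_ _] := hP n; apply; rewrite ?leqnn.
(* A nonzero sample is taken at a point of the support of [g], hence in [K n], and the mesh [h m]
   serves every [n <= m]. *)
- move=> n m g nm gK; apply: (tensor_smooth_sample _ _ (u_supp m)) => z _ gz y.
  have [_ _] := hP m; apply=> //; apply: gK.
  have [Oz|nOz] := pselect (Omega (lattice (h m) z)); last first.
    by rewrite valL_out// eqxx in gz.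
  pose x : Omega := exist _ (lattice (h m) z) (mem_set Oz).
  by exists x => //; apply: subset_closure; rewrite /= -(valL_val g x).
Qed.
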